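(* Let $M$ be a manifold with a torsion-free connection $\nabla$ whose holonomy algebra $\mathfrak g$ at $o\in M$ satisfies $T_oM=V_1\oplus V_2$ with $V_1$ and $V_2$ ($\mathfrak g$-invariant and) faithful representations of $\mathfrak g$, and let $\mathcal F_1,\mathcal F_2$, $x_o^i$, $y_o^j$, $y_q^j$ be as described in the context. Let $a_k^l$ and $\tilde a_l^m$ be the functions defined by $$\partial_{y_q^k,p}=\sum_l a_k^l(p)\,\partial_{y_o^l,p},\qquad \partial_{y_o^l,p}=\sum_m\tilde a_l^m(p)\,\partial_{y_q^m,p},$$ where $q$ is the intersection point of $\mathcal F_2(p)$ with $\mathcal F_1(o)$, and let $\Gamma_{i,k}^m$ be defined by $\nabla_{\partial_{x_o^i}}\partial_{x_o^k}=\sum_m\Gamma_{i,k}^m\,\partial_{x_o^m}$. Then, at each point $p$, $$R_p(\partial_{x_o^i},\partial_{y_o^j})\partial_{x_o^k}=-\sum_m\partial_{y_o^j}\big(\Gamma_{i,k}^m\big)\,\partial_{x_o^m},$$ $$R_p(\partial_{x_o^i},\partial_{y_o^j})\partial_{y_q^k}=-\sum_m\partial_{y_o^j}\Big(\sum_l(\partial_{x_o^i}a_k^l)\,\tilde a_l^m\Big)\,\partial_{y_q^m}.$$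
   Context: The holonomy algebra is the Lie algebra of the restricted holonomy group of $\nabla$ at $o$. The curvature is $R(X,Y)Z=\nabla_X\nabla_YZ-\nabla_Y\nabla_XZ-\nabla_{[X,Y]}Z$. The whole setting is local: $M$ stands for a sufficiently small simply connected neighbourhood of $o$ on which all of the following is defined. Parallel transport of $V_1$ and $V_2$ gives two parallel distributions on $M$, which are integrable; they define foliations $\mathcal F_1$ and $\mathcal F_2$ (tangent to the transports of $V_1$, $V_2$ respectively) whose leaves are flat for $\nabla$. $\mathcal F_i(p)$ denotes the leaf through $p$. Locally $M$ is a product: each leaf of $\mathcal F_1$ meets each leaf of $\mathcal F_2$ in exactly one point. Let $n_i=\dim V_i$. Coordinates: on $\mathcal F_1(o)$ choose coordinates $x_o^i$ ($1\le i\le n_1$) with $\nabla_{\partial_{x_o^i}}\partial_{x_o^j}=0$ for all $i,j$ on $\mathcal F_1(o)$; on $\mathcal F_2(o)$ choose coordinates $y_o^j$ ($1\le j\le n_2$) with $\nabla_{\partial_{y_o^i}}\partial_{y_o^j}=0$ on $\mathcal F_2(o)$. For $p\in M$, with $q$ the intersection point of $\mathcal F_2(p)$ with $\mathcal F_1(o)$ and $r$ the intersection point of $\mathcal F_1(p)$ with $\mathcal F_2(o)$, set $x_o^i(p):=x_o^i(q)$ and $y_o^j(p):=y_o^j(r)$. Then $(x_o^i,y_o^j)$ are coordinates on $M$, and $\partial_{x_o^i},\partial_{y_o^j}$ denote the associated coordinate vector fields on $M$ (so, e.g., $\partial_{x_o^i}$ applied to a function is the partial derivative with all other $x_o$'s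 and all $y_o$'s fixed). For $q\in\mathcal F_1(o)$, $y_q^j$ ($1\le j\le n_2$) are coordinates on the leaf $\mathcal F_2(q)$ such that $\nabla_{\partial_{y_q^i}}\partial_{y_q^j}=0$ on $\mathcal F_2(q)$ for all $i,j$ and such that $\partial_{y_q^j,q}$ is the parallel transport of $\partial_{y_o^j,o}$ along the leaf $\mathcal F_1(o)$. A second index denotes the point at which a vector field is evaluated; letting $q$ vary with $p$, $p\mapsto\partial_{y_q^k,p}$ is a vector field on $M$. *)

(* Defs.v *)
(* MathComp-Analysis.  The setting is local: [M] is an open subset of
   ['rV[R]_n] (the image of a chart), every tangent space is ['rV[R]_n] itself,
   and a vector field on [M] is a total function of which only the values on
   [M] matter.  Endomorphisms of a tangent space act on row vectors from the
   right. *)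
From HB Require Import structures.
From mathcomp Require Import all_boot all_order all_algebra.
From mathcomp Require Import all_classical all_reals all_analysis.

Set Implicit Arguments.
Unset Strict Implicit.
Unset Printing Implicit Defensive.

Import Order.TTheory GRing.Theory Num.Theory.
Import numFieldNormedType.Exports.

Local Open Scope classical_set_scope.
Local Open Scope ring_scope.

Section Smoothness.
Context {R : realType} {V W : normedModType R}.

Fixpoint iter_derive (vs : seq V) (f : V -> W) : V -> W :=
  if vs is v :: vs' then iter_derive vs' (fun p => 'D_v f p) else f.

(* C^infinity on [U], meant for open [U]. *)
Definition smooth_on (U : set V) (f : V -> W) : Prop :=
  forall (vs : seq V) (p : V), U p -> differentiable (iter_derive vs f) p.

End Smoothness.

Section Curves.
Context {R : realType} {n : nat}.
Local Notation E := 'rV[R]_n.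
Implicit Types (M : set E) (c : R -> E).

(* Smoothness on a closed piece means smooth extendability to an open
   neighbourhood of it; continuity on [`[a, b]] follows, because neighbouring
   pieces share their endpoints. *)
Definition piecewise_smooth (a b : R) c : Prop :=
  exists s : seq R, itv_partition a b s /\
    forall i, (i < size s)%N ->
      exists (U : set R) (g : R -> E),
        [/\ open U, smooth_on U g &
          forall t, nth b (a :: s) i <= t <= nth b s i -> U t /\ c t = g t].

Definition path_in M (a b : R) (p q : E) c : Prop :=
  [/\ a < b, piecewise_smooth a b c, c a = p, c b = q &
      forall t, a <= t <= b -> M (c t)].

Definition null_homotopic M c : Prop :=
  exists H : R * R -> E,
    [/\ {within `[0, 1] `*` `[0, 1], continuous H},
        forall s t, 0 <= s <= 1 -> 0 <= t <= 1 -> M (H (s, t)),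
        forall t, 0 <= t <= 1 -> H (0, t) = c t /\ H (1, t) = c 0 &
        forall s, 0 <= s <= 1 -> H (s, 0) = c 0 /\ H (s, 1) = c 0].

(* For open [M], connectedness is the same as path-connectedness. *)
Definition simply_connected M : Prop :=
  connected M /\
  forall c, {within `[0, 1], continuous c} ->
    (forall t, 0 <= t <= 1 -> M (c t)) -> c 0 = c 1 -> null_homotopic M c.

End Curves.

Section Connections.
Context {R : realType} {n : nat}.
Local Notation E := 'rV[R]_n.
Implicit Types (M : set E) (X Y Z : E -> E) (c U : R -> E) (f : E -> R).

Definition lie_bracket X Y : E -> E :=
  fun p => 'D_(X p) Y p - 'D_(Y p) X p.

Record connection M (nabla : (E -> E) -> (E -> E) -> E -> E) : Prop := {
  nabla_smooth : forall X Y, smooth_on M X -> smooth_on M Y ->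
    smooth_on M (nabla X Y);
  nabla_ext : forall X X' Y Y',
    (forall p, M p -> X p = X' p) -> (forall p, M p -> Y p = Y' p) ->
    forall p, M p -> nabla X Y p = nabla X' Y' p;
  nabla_addl : forall X X' Y,
    smooth_on M X -> smooth_on M X' -> smooth_on M Y ->
    forall p, M p ->
      nabla (fun r => X r + X' r) Y p = nabla X Y p + nabla X' Y p;
  nabla_scalel : forall f X Y,
    smooth_on M (f : E -> R^o) -> smooth_on M X -> smooth_on M Y ->
    forall p, M p -> nabla (fun r => f r *: X r) Y p = f p *: nabla X Y p;
  nabla_addr : forall X Y Y',
    smooth_on M X -> smooth_on M Y -> smooth_on M Y' ->
    forall p, M p ->
      nabla X (fun r => Y r + Y' r) p = nabla X Y p + nabla X Y' p;
  nabla_leibniz : forall f X Y,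
    smooth_on M (f : E -> R^o) -> smooth_on M X -> smooth_on M Y ->
    forall p, M p ->
      nabla X (fun r => f r *: Y r) p
      = 'D_(X p) (f : E -> R^o) p *: Y p + f p *: nabla X Y p }.

Variables (M : set E) (nabla : (E -> E) -> (E -> E) -> E -> E).

Definition torsion_free : Prop :=
  forall X Y, smooth_on M X -> smooth_on M Y ->
  forall p, M p -> nabla X Y p - nabla Y X p = lie_bracket X Y p.

Definition curvature X Y Z : E -> E :=
  fun p => nabla X (nabla Y Z) p - nabla Y (nabla X Z) p
           - nabla (lie_bracket X Y) Z p.

(* [u, v |-> nabla (cst u) (cst v) p] is the bilinear map given by the
   Christoffel symbols of the ambient chart at [p], so the equation says that
   the covariant derivative of [U] along [c] vanishes, off the finitely many
   break points of [c]. *)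
Definition parallel_along (a b : R) c U : Prop :=
  {within `[a, b], continuous U} /\
  exists s : seq R, forall t, a < t < b -> t \notin s ->
    is_derive (t : R) (1 : R) U (- nabla (cst ('D_1 c t)) (cst (U t)) (c t)).

Definition parallel_transport (a b : R) c (v w : E) : Prop :=
  exists U, [/\ parallel_along a b c U, U a = v & U b = w].

Definition restricted_holonomy (o : E) : set 'M[R]_n :=
  [set A | exists c, [/\ path_in M 0 1 o o c, null_homotopic M c &
     forall v, parallel_transport 0 1 c v (v *m A)]].

(* The subspace field [D] consists of the parallel transports of [V]. *)
Definition transported (o : E) (V : {vspace E}) (D : E -> {vspace E}) : Prop :=
  forall p a b c, path_in M a b o p c ->
  forall w, w \in D p <->
    exists2 v, v \in V & parallel_transport a b c v w.

End Connections.

(* Lie algebra of a group of matrices: initial velocities of the one-parameter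
   subgroups, i.e. all [A] with exp(tA) in [G] for every [t]. *)
Definition lie_algebra {R : realType} {n : nat} (G : set 'M[R]_n) :
    set 'M[R]_n :=
  [set A | exists phi : R -> 'M[R]_n,
     [/\ forall s t, phi (s + t) = phi s *m phi t, phi 0 = 1%:M,
         is_derive (0 : R) (1 : R) phi A & forall t, G (phi t)]].

Definition invariant_under {R : realType} {n : nat} (g : set 'M[R]_n)
    (V : {vspace 'rV[R]_n}) : Prop :=
  forall A, g A -> forall v, v \in V -> v *m A \in V.

Definition faithful_on {R : realType} {n : nat} (g : set 'M[R]_n)
    (V : {vspace 'rV[R]_n}) : Prop :=
  forall A, g A -> (forall v, v \in V -> v *m A = 0) -> A = 0.

Section Foliations.
Context {R : realType} {n : nat}.
Local Notation E := 'rV[R]_n.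
Implicit Types (M : set E) (D : E -> {vspace E}).

Definition param_field {k : nat} (psi : 'rV[R]_k -> E) (j : 'I_k) :
    'rV[R]_k -> E :=
  fun u => 'D_(delta_mx 0 j) psi u.

(* Through every point there is an integral manifold of [D]. *)
Definition integrable_distribution M D : Prop :=
  forall p, M p ->
  exists (k : nat) (W : set 'rV[R]_k) (psi : 'rV[R]_k -> E),
    [/\ open W, smooth_on W psi, exists2 u, W u & psi u = p &
        forall u, W u ->
          M (psi u) /\
          basis_of (D (psi u)) [tuple param_field psi j u | j < k]].

(* [leaf M D p] is the leaf through [p] of the foliation tangent to [D]: for
   an integrable distribution, the maximal connected integral manifold through
   [p] is the set of endpoints of the curves from [p] tangent to [D]. *)
Definition tangent_curve M D (a b : R) (p q : E) (c : R -> E) : Prop :=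
  path_in M a b p q c /\
  exists s : seq R, forall t, a < t < b -> t \notin s ->
    'D_1 c t \in D (c t).

Definition leaf M D (p : E) : set E :=
  [set q | exists a b c, tangent_curve M D a b p q c].

(* Coordinates [z] on the leaf [L], given with the inverse chart [psi], for
   which the coordinate fields form a frame of [D] along [L]. *)
Record leaf_coordinates D (L : set E) (k : nat) (z : E -> 'rV[R]_k)
    (psi : 'rV[R]_k -> E) : Prop := {
  lc_open : open (z @` L);
  lc_smooth : smooth_on (z @` L) psi;
  lc_cancel : forall p, L p -> psi (z p) = p;
  lc_frame : forall p, L p ->
    basis_of (D p) [tuple param_field psi j (z p) | j < k] }.

(* The covariant derivative, along the leaf, of the [j]-th coordinate field in
   the direction of the [i]-th one is zero. *)
Definition affine_coordinates (nabla : (E -> E) -> (E -> E) -> E -> E)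
    (L : set E) (k : nat) (z : E -> 'rV[R]_k) (psi : 'rV[R]_k -> E) : Prop :=
  forall p (i j : 'I_k), L p ->
    'D_(delta_mx 0 i) (param_field psi j) (z p)
    + nabla (cst (param_field psi i (z p))) (cst (param_field psi j (z p))) p
    = 0.

(* [(x, y)] are coordinates on [M] with coordinate vector fields [dx], [dy];
   the latter are determined by duality when [n = n1 + n2]. *)
Record coordinates M (n1 n2 : nat) (x : E -> 'rV[R]_n1) (y : E -> 'rV[R]_n2)
    (dx : 'I_n1 -> E -> E) (dy : 'I_n2 -> E -> E) : Prop := {
  co_smooth : smooth_on M x /\ smooth_on M y;
  co_inj : forall p q, M p -> M q -> x p = x q -> y p = y q -> p = q;
  co_fields : (forall i, smooth_on M (dx i)) /\ (forall j, smooth_on M (dy j));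
  co_dx : forall i p, M p ->
    'D_(dx i p) x p = delta_mx 0 i /\ 'D_(dx i p) y p = 0;
  co_dy : forall j p, M p ->
    'D_(dy j p) x p = 0 /\ 'D_(dy j p) y p = delta_mx 0 j }.

End Foliations.

(* Main.v *)
(* D1 and D2 are the parallel distributions of the two foliations.  Since the
   connection is torsion free and [dx_i, dy_j] = 0, the vector
   nabla_{dx_i} dy_j = nabla_{dy_j} dx_i lies in D1 and in D2, hence vanishes;
   moreover dyq_k is parallel along D2 because the y_q are affine.  So the only
   surviving term of the curvature is - nabla_{dy_j} of nabla_{dx_i} dx_k, resp.
   of nabla_{dx_i} dyq_k, whose components in the frame dx, resp. dyq, which is
   parallel in the direction dy_j, simply get differentiated.

   That D2 is spanned by the dy_j everywhere is read off the coordinates y_q.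
   For D1 this is known on the leaf through o only; it is propagated along the
   leaves of D2 by transporting dx_k parallelly.  The transport is explicit: by
   the flatness of dyq it is dx_k + sum_m phi_m dyq_m with the phi_m obtained by
   quadrature, so no existence theorem for differential equations is needed. *)
Require Import Defs.
From HB Require Import structures.
From mathcomp Require Import all_boot all_order all_algebra.
From mathcomp Require Import all_classical all_reals all_analysis.
Set Implicit Arguments.
Unset Strict Implicit.
Unset Printing Implicit Defensive.
Import Order.TTheory GRing.Theory Num.Theory.
Import numFieldNormedType.Exports.
Local Open Scope classical_set_scope.
Local Open Scope ring_scope.

(** * Differential calculus *)

Section Calculus.
Context {R : realType}.
Implicit Types (V W : normedModType R).

(** The subspace fields [D1] and [D2] are given pointwise and are never differentiated. Belonging to
    them is replaced by linear tests: [x] is constant on the leaves of [D2] and [y] on those of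
    [D1], so the derivative of [x] vanishes along vectors of [D2], that of [y] along vectors of
    [D1], and a vector passing both tests is zero. For such a test map [z], parallelism of the
    distribution becomes an identity between a Christoffel term and a second derivative of [z]. By
    the Schwarz theorem the derivative of a section contributes the opposite second derivative, so
    the covariant derivative of a section passes the test again.

    The tests are one-sided: they place [D1 p] inside the span of the [dx], and equality is a matter
    of dimension, which a frame supplies on the leaf through [o]. Elsewhere the correction term of
    the explicit transport is itself submitted to both tests, and therefore vanishes at the
    endpoint. *)

Lemma near_on V W (U : set V) (f g : V -> W) p : open U ->
  (forall q, U q -> f q = g q) -> U p -> \forall q \near p, f q = g q.
Proof.
move=> oU fg Up; have Up' : nbhs p U by exact: open_nbhs_nbhs.
exact: filterS Up'.
Qed.

Lemma near_eq_differentiable V W (f g : V -> W) p :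
  (\forall q \near p, f q = g q) -> differentiable f p -> differentiable g p.
Proof.
move=> nfg /diff_locallyP[df fE].
have fgp : f p = g p by exact: nbhs_singleton nfg.
have gE : g \o shift p = cst (g p) + 'd f p +o_ (0 : V) id.
  have nfg0 : \forall q \near (0 : V), f (q + p) = g (q + p).
    by move: nfg; rewrite (near_shift 0) subr0.
  move/eqaddoP : fE => fE; apply/eqaddoP => e e0; near=> q.
  have -> : (g \o shift p - (cst (g p) + 'd f p)) q =
            (f \o shift p - (cst (f p) + 'd f p)) q.
    suff E : f (q + p) = g (q + p) by rewrite !fctE /= E fgp.
    by near: q.
  by near: q; exact: fE.
have dgE := diff_unique df gE.
by apply/diff_locallyP; rewrite dgE.
Unshelve. all: by end_near. Qed.

Lemma derive_sumE V W n (f : 'I_n -> V -> W) p v :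
  (forall i, differentiable (f i) p) ->
  'D_v (fun x => \sum_i f i x) p = \sum_i 'D_v (f i) p.
Proof.
move=> df; rewrite -derive_sum => [|i]; last exact: diff_derivable.
by congr ('D_v _ p); apply/funext => x; rewrite fct_sumE.
Qed.

Lemma differentiable_bigsum V W I (r : seq I) (f : I -> V -> W) p :
  (forall i, differentiable (f i) p) ->
  differentiable (fun x => \sum_(i <- r) f i x) p.
Proof.
move=> df; elim: r => [|i r IH].
  have -> : (fun x => \sum_(i <- [::]) f i x) = cst 0.
    by apply/funext => x; rewrite big_nil.
  exact: differentiable_cst.
have -> : (fun x => \sum_(j <- i :: r) f j x) =
    f i + (fun x => \sum_(j <- r) f j x).
  by apply/funext => x; rewrite big_cons.
exact: differentiableD.
Qed.

Lemma scale_is_bilinear W : bilinear_for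
    (GRing.Scale.Law.clone _ _ *:%R _) (GRing.Scale.Law.clone _ _ *:%R _)
    (@GRing.scale R W : R^o -> W -> W).
Proof.
split=> [u'|u] a x y /=.
- by rewrite scalerDl scalerA.
- by rewrite scalerDr !scalerA mulrC.
Qed.

(** Scaling is packed as a continuous bilinear map, so the product rule is the differential of a
    bilinear map composed with a pair. *)
Lemma is_diff_scale V W (k : V -> R^o) (F : V -> W) p :
  differentiable k p -> differentiable F p ->
  differentiable (fun x => k x *: F x) p /\
  (forall v, 'D_v (fun x => k x *: F x) p = 'D_v k p *: F p + k p *: 'D_v F p).
Proof.
move=> dk dF.
pose sM := bilinear_isBilinear.Build _ _ _ _ _ _ _ (scale_is_bilinear W).
pose s : {bilinear R^o -> W -> W} := HB.pack (@GRing.scale R W : R^o -> W -> W) sM.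
have sc : continuous (fun q : R^o * W => s q.1 q.2) by exact: scale_continuous.
pose h := fun x => (k x, F x) : R^o * W.
have dh : differentiable h p by exact: differentiable_pair.
have ds : differentiable (fun q : R^o * W => s q.1 q.2) (h p).
  exact: differentiable_bilin.
have dkF : differentiable (fun x => k x *: F x) p.
  exact: (@differentiable_comp _ _ _ _ h (fun q : R^o * W => s q.1 q.2)).
split=> // v; rewrite deriveE //.
rewrite (@diff_comp _ _ _ _ h (fun q : R^o * W => s q.1 q.2)) //=.
have := @diff_bilin _ _ _ _ s (h p) sc.
move=> ->; rewrite diff_pair //= !deriveE //.
by rewrite addrC.
Qed.

Lemma derive_comp V W (T : normedModType R) (c : T -> V) (f : V -> W) t u :
  differentiable c t -> differentiable f (c t) ->
  'D_u (fun s => f (c s)) t = 'D_('D_u c t) f (c t).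
Proof.
move=> dc df; rewrite deriveE; last exact: (@differentiable_comp _ _ _ _ c f).
by rewrite (@diff_comp _ _ _ _ c f) // !deriveE.
Qed.

Lemma derive_dir_sum V W n (f : V -> W) p (k : 'I_n -> R) (v : 'I_n -> V) :
  differentiable f p ->
  'D_(\sum_i k i *: v i) f p = \sum_i k i *: 'D_(v i) f p.
Proof.
move=> df; rewrite deriveE // linear_sum; apply: eq_bigr => i _.
by rewrite linearZ deriveE.
Qed.

Lemma derive_dirZ V W (f : V -> W) p k v :
  differentiable f p -> 'D_(k *: v) f p = k *: 'D_v f p.
Proof. by move=> df; rewrite !deriveE // linearZ. Qed.

Lemma derive_dirD V W (f : V -> W) p v w :
  differentiable f p -> 'D_(v + w) f p = 'D_v f p + 'D_w f p.
Proof. by move=> df; rewrite !deriveE // linearD. Qed.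

Lemma derive_dirB V W (f : V -> W) p v w :
  differentiable f p -> 'D_(v - w) f p = 'D_v f p - 'D_w f p.
Proof. by move=> df; rewrite !deriveE // linearB. Qed.

Lemma coord_linear n (i : 'I_n) W (w : W) : 
  linear (fun u : 'rV[R]_n => u 0 i *: w).
Proof. by move=> a u v; rewrite !mxE scalerDl scalerA. Qed.

(** The map [u |-> u 0 i *: w] is linear and continuous. Keeping [w] general covers scalar
    coordinates ([w = 1]) as well as the terms of an expansion in the standard basis. *)
Lemma coordZ_diff V W n (f : V -> 'rV[R]_n) (w : W) i p :
  differentiable f p -> differentiable (fun q => f q 0 i *: w) p /\
  forall v, 'D_v (fun q => f q 0 i *: w) p = 'D_v f p 0 i *: w.
Proof.
move=> df.
pose LM := GRing.isLinear.Build _ _ _ _ _ (coord_linear i w).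
pose L : {linear _ -> _} := HB.pack (fun u : 'rV[R]_n => u 0 i *: w) LM.
have Lc : continuous L.
  by move=> u; exact: (continuousZr_tmp (@coord_continuous R 1 n 0 i u)).
have dL : differentiable L (f p) by exact: linear_differentiable.
split=> [|v]; first exact: (@differentiable_comp _ _ _ _ f L).
have -> : (fun q => f q 0 i *: w) = (fun q => L (f q)) by [].
by rewrite (@derive_comp _ _ _ f L) // deriveE // diff_lin.
Qed.

Lemma coord_diff V n (f : V -> 'rV[R]_n) i p :
  differentiable f p -> differentiable (fun q => f q 0 i : R^o) p /\
  forall v, 'D_v (fun q => f q 0 i : R^o) p = 'D_v f p 0 i.
Proof.
move=> /(@coordZ_diff _ R^o n f 1 i p).
have -> : (fun q => f q 0 i *: (1 : R^o)) = (fun q => f q 0 i).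
  by apply/funext => q; exact: mulr1.
by move=> [? H]; split=> // v; rewrite H; exact: mulr1.
Qed.

Lemma iter_derive_eq_on V W (U : set V) (f g : V -> W) vs p : open U ->
  (forall q, U q -> f q = g q) -> U p -> iter_derive vs f p = iter_derive vs g p.
Proof.
move=> oU; elim: vs f g p => [|v vs IH] f g p fg Up /=; first exact: fg.
by apply: IH => // q Uq; apply: near_eq_derive; exact: near_on Uq.
Qed.

Lemma smooth_on_eq V W (U : set V) (f g : V -> W) : open U ->
  (forall q, U q -> f q = g q) -> smooth_on U f -> smooth_on U g.
Proof.
move=> oU fg sf vs p Up; apply: near_eq_differentiable (sf vs p Up).
by apply: (near_on oU _ Up) => q Uq; exact: iter_derive_eq_on Uq.
Qed.

Lemma smooth_diff V W (U : set V) (f : V -> W) p :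
  smooth_on U f -> U p -> differentiable f p.
Proof. by move=> sf; exact: (sf [::]). Qed.

Lemma smooth_derive V W (U : set V) (f : V -> W) v :
  smooth_on U f -> smooth_on U (fun p => 'D_v f p).
Proof. by move=> sf vs; exact: (sf (v :: vs)). Qed.

Lemma smooth_cst V W (U : set V) (w : W) : smooth_on U (fun _ : V => w).
Proof.
move=> vs p _; elim: vs w => [|v vs IH] w /=; first exact: differentiable_cst.
have -> : (fun q => 'D_v (fun _ : V => w) q) = (fun=> 0); last exact: IH.
by apply/funext => q; exact: derive_cst.
Qed.

Lemma smooth_coordZ V W n (U : set V) (f : V -> 'rV[R]_n) (w : W) i : open U ->
  smooth_on U f -> smooth_on U (fun q => f q 0 i *: w).
Proof.
move=> oU + vs; elim: vs f => [|v vs IH] f sf p Up /=.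
  by have [] := coordZ_diff w i (smooth_diff sf Up).
have := IH _ (smooth_derive v sf) p Up; apply: near_eq_differentiable.
apply: (near_on oU _ Up) => q Uq; apply: iter_derive_eq_on Uq => // r Ur.
by have [_ ->] := coordZ_diff w i (smooth_diff sf Ur).
Qed.

Lemma smooth_coord V n (U : set V) (f : V -> 'rV[R]_n) i : open U ->
  smooth_on U f -> smooth_on U (fun q => f q 0 i : R^o).
Proof.
move=> oU /(@smooth_coordZ _ R^o n U f 1 i oU).
by apply: smooth_on_eq => // q _; exact: mulr1.
Qed.

(** Both sides are limits of the same difference quotient, so the equality holds even where [f] is
    not differentiable. *)
Lemma derive_comp_affine V W (f : V -> W) (u0 l : V) (t v : R^o) :
  'D_v (fun s : R^o => f (u0 + s *: l)) t = 'D_(v *: l) f (u0 + t *: l).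
Proof.
pose g (s : R^o) := f (u0 + s *: l).
have E : (fun h : R => h^-1 *: ((g \o shift t) (h *: v) - g t)) =
    (fun h => h^-1 *: ((f \o shift (u0 + t *: l)) (h *: (v *: l)) - g t)).
  apply/funext => h /=.
  by rewrite /g scalerDl addrCA [h *: v]/(h * v) -scalerA.
by rewrite /derive E.
Qed.

Lemma affine_diff V (u0 l : V) (t : R^o) :
  differentiable (fun s : R^o => u0 + s *: l) t.
Proof.
apply: differentiableD; first exact: differentiable_cst.
by apply: differentiableZl.
Qed.

Lemma smooth_comp_affine V W (f : V -> W) (u0 l : V) (U : set V) :
  smooth_on U f ->
  smooth_on [set t : R^o | U (u0 + t *: l)] (fun t : R^o => f (u0 + t *: l)).
Proof.
move=> sf vs t Ut.
(* An equality of functions on the whole line, because [derive_comp_affine] is unconditional; each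
   scalar direction [v] becomes [v *: l]. *)
have E : iter_derive vs (fun t : R^o => f (u0 + t *: l)) =
    (fun t => iter_derive [seq v *: l | v <- vs] f (u0 + t *: l)).
  elim: vs f {sf} => [//|v vs IH] f /=; rewrite -IH; congr iter_derive.
  by apply/funext => s; exact: derive_comp_affine.
rewrite E; apply: (@differentiable_comp _ _ _ _ (fun t : R^o => u0 + t *: l)).
  exact: affine_diff.
exact: sf.
Qed.

Lemma smooth_id V (U : set V) : smooth_on U (@id V).
Proof.
move=> [|v vs] p Up /=; first by apply: ex_diff.
have -> : (fun q => 'D_v (@id V) q) = (fun=> v); last exact: (@smooth_cst _ _ U).
by apply/funext => q; exact: derive_id.
Qed.

(** Chain rule for a derivative whose base point and direction both vary: expanding the direction in
    the standard basis reduces it to the product rule. The domain [T] is general so that [c] may be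
    a curve or the identity. *)
Lemma derive_dir_rule (T : normedModType R) W n (U : set 'rV[R]_n)
    (f : 'rV[R]_n -> W) (c Z : T -> 'rV[R]_n) t :
  open U -> smooth_on U f -> U (c t) ->
  differentiable c t -> differentiable Z t ->
  differentiable (fun s => 'D_(Z s) f (c s)) t /\
  forall u, 'D_u (fun s => 'D_(Z s) f (c s)) t =
    'D_('D_u Z t) f (c t) + 'D_('D_u c t) (fun r => 'D_(Z t) f r) (c t).
Proof.
move=> oU sf Uc dc dZ.
have sumE w r : U r -> 'D_w f r = \sum_i w 0 i *: 'D_(delta_mx 0 i) f r.
  by move=> Ur; rewrite {1}[w]row_sum_delta derive_dir_sum //; exact: smooth_diff Ur.
have nE : \forall s \near t, \sum_i Z s 0 i *: 'D_(delta_mx 0 i) f (c s)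
    = 'D_(Z s) f (c s).
  have cc : {for t, continuous c} by exact: differentiable_continuous.
  have : \forall s \near t, U (c s) by apply: cc; exact: open_nbhs_nbhs.
  by apply: filterS => s Us; rewrite sumE.
have dterm i := is_diff_scale (coord_diff i dZ).1
  (@differentiable_comp _ _ _ _ c (fun r => 'D_(delta_mx 0 i) f r) t dc
     (smooth_diff (smooth_derive (delta_mx 0 i) sf) Uc)).
split=> [|u].
  apply: near_eq_differentiable nE _; apply: differentiable_bigsum => i.
  exact: (dterm i).1.
rewrite -(near_eq_derive _ nE) derive_sumE => [|i]; last exact: (dterm i).1.
under eq_bigr => i _ do rewrite (dterm i).2 (coord_diff i dZ).2.
rewrite big_split /= -sumE //; congr (_ + _).
have -> : 'D_('D_u c t) (fun r => 'D_(Z t) f r) (c t) =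
    'D_('D_u c t) (fun r => \sum_i Z t 0 i *: 'D_(delta_mx 0 i) f r) (c t).
  by apply: near_eq_derive; apply: (near_on oU _ Uc) => q Uq; rewrite sumE.
have df i := smooth_diff (smooth_derive (delta_mx 0 i) sf) Uc.
rewrite derive_sumE => [|i]; last by apply: differentiableZ; exact: df.
apply: eq_bigr => i _; rewrite deriveZ; last exact: diff_derivable.
congr (_ *: _); exact: (@derive_comp _ _ _ c).
Qed.

End Calculus.

(** * Symmetry of second derivatives *)

Section Schwarz.
Context {R : realType}.
Implicit Types (V W : normedModType R).

Lemma line_is_derive V W (f : V -> W) (w u : V) (s : R) :
  differentiable f (w + s *: u) ->
  is_derive s (1 : R) (fun s : R => f (w + s *: u)) ('D_u f (w + s *: u)).
Proof.
move=> df; apply: DeriveDef.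
  apply: diff_derivable.
  exact: (@differentiable_comp _ R^o _ _ _ _ _ (affine_diff w u s) df).
by rewrite (@derive_comp_affine _ _ _ f w u s 1) scale1r.
Qed.

Lemma nbhs_square V (Q : set V) p u v : nbhs p Q ->
  exists2 r : R, 0 < r & forall s t, `|s| < r -> `|t| < r ->
    Q (p + s *: u + t *: v).
Proof.
move=> /nbhs_ballP[e e0 eQ].
have N0 : 0 < `|u| + `|v| + 1 by rewrite ltr_wpDl // addr_ge0.
(* The [+ 1] keeps the denominator positive when [u] and [v] both vanish. *)
exists (e / (`|u| + `|v| + 1)); first by rewrite divr_gt0.
move=> s t; rewrite !ltr_pdivlMr // => se te; apply: eQ.
rewrite -ball_normE /= -addrA opprD addrA subrr sub0r normrN.
apply: le_lt_trans (ler_normD _ _) _; rewrite !normrZ.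
have [st|ts] := leP `|s| `|t|.
  apply: le_lt_trans te; rewrite !mulrDr mulr1 ler_wpDr // lerD2r.
  by rewrite ler_wpM2r.
apply: le_lt_trans se; rewrite !mulrDr mulr1 ler_wpDr // lerD2l.
by rewrite ler_wpM2r // ltW.
Qed.

(* Mean value theorem, first in the direction u, then in the direction v. *)
Lemma second_difference V (f : V -> R^o) (U : set V) p u v (r h : R) :
  smooth_on U f ->
  (forall s t, `|s| < r -> `|t| < r -> U (p + s *: u + t *: v)) ->
  0 < h < r ->
  exists c d : R, [/\ 0 < c < h, 0 < d < h &
    f (p + h *: u + h *: v) - f (p + h *: u) - (f (p + h *: v) - f p)
    = 'D_v (fun q => 'D_u f q) (p + c *: u + d *: v) * h * h].
Proof.
move=> sf rU /andP[h0 hr].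
have absE s : 0 <= s <= h -> `|s| < r.
  by move=> /andP[s0 sh]; rewrite ger0_norm //; exact: le_lt_trans hr.
pose G s := f (p + h *: v + s *: u) - f (p + s *: u).
have inU s t : 0 <= s <= h -> 0 <= t <= h -> U (p + t *: v + s *: u).
  by move=> s0 t0; rewrite addrAC; apply: rU; exact: absE.
have inU0 s : 0 <= s <= h -> U (p + s *: u).
  move=> s0; have := inU _ 0 s0; rewrite scale0r addr0; apply.
  by rewrite lexx ltW.
have oocc s : s \in `]0, h[ -> 0 <= s <= h.
  by rewrite in_itv /= => /andP[s0 sh]; rewrite !ltW.
have hh : 0 <= h <= h by rewrite lexx ltW.
have dG s : 0 <= s <= h -> is_derive s (1 : R) (G : R -> R)
    ('D_u f (p + h *: v + s *: u) - 'D_u f (p + s *: u)).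
  move=> s0; apply: is_deriveB; apply: line_is_derive; apply: smooth_diff sf _.
    exact: inU.
  exact: inU0.
have [|c + GE] := @MVT R G _ 0 h h0 (fun s s0 => dG s (oocc s s0)).
  apply: derivable_within_continuous => s; rewrite in_itv /= => s0.
  by have [] := dG s s0.
rewrite in_itv /= => /andP[c0 ch].
have cc : 0 <= c <= h by rewrite !ltW.
pose H t := 'D_u f (p + c *: u + t *: v).
have dH t : 0 <= t <= h -> is_derive t (1 : R) (H : R -> R)
    ('D_v (fun q => 'D_u f q) (p + c *: u + t *: v)).
  move=> t0; apply: (@line_is_derive _ _ (fun q => 'D_u f q)).
  apply: smooth_diff (smooth_derive _ sf) _.
  by rewrite addrAC; exact: inU.
have [|d + HE] := @MVT R H _ 0 h h0 (fun s s0 => dH s (oocc s s0)).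
  apply: derivable_within_continuous => s; rewrite in_itv /= => s0.
  by have [] := dH s s0.
rewrite in_itv /= => d0; exists c, d; split => //; first by rewrite c0 ch.
move: GE HE; rewrite /G /H !scale0r !addr0 !subr0 => GE HE.
by rewrite [p + h *: u + _]addrAC GE -HE addrAC.
Qed.

(** The mean value theorem yields equal values of the two mixed derivatives at two different points
    near [p]; continuity at [p] with an [e / 2] argument brings them together. *)
Lemma continuous_eq_close V (A B : V -> R^o) p :
  {for p, continuous A} -> {for p, continuous B} ->
  (forall N, nbhs p N -> exists q1 q2, [/\ N q1, N q2 & A q1 = B q2]) ->
  A p = B p.
Proof.
move=> cA cB H; apply/eqP; rewrite -subr_eq0 -normr_le0.
apply/ler_addgt0Pl => e e0; rewrite addr0.
have e20 : 0 < e / 2 by rewrite divr_gt0.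
have nF (F : V -> R^o) : {for p, continuous F} ->
    nbhs p [set q | `|F p - F q| < e / 2].
  by move=> /cvgrPdist_lt /(_ _ e20).
have [q1 [q2 [[a1 _] [_ a2] E]]] := H _ (filterI (nF _ cA) (nF _ cB)).
rewrite /= in a1 a2; rewrite [e]splitr.
have -> : A p - B p = (A p - A q1) - (B p - B q2) by rewrite E opprB addrA subrK.
by apply: le_trans (ler_normB _ _) _; rewrite lerD // ltW.
Qed.

Lemma schwarz_scalar V (f : V -> R^o) (U : set V) p u v : open U ->
  smooth_on U f -> U p ->
  'D_v (fun q => 'D_u f q) p = 'D_u (fun q => 'D_v f q) p.
Proof.
move=> oU sf Up.
apply: (@continuous_eq_close _ (fun q => 'D_v (fun q => 'D_u f q) q)
  (fun q => 'D_u (fun q => 'D_v f q) q)).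
- apply: differentiable_continuous.
  exact: smooth_diff (smooth_derive v (smooth_derive u sf)) Up.
- apply: differentiable_continuous.
  exact: smooth_diff (smooth_derive u (smooth_derive v sf)) Up.
move=> N nN; have nU : nbhs p U by exact: open_nbhs_nbhs.
have [r1 r10 H1] := nbhs_square u v (filterI nU nN).
have [r2 r20 H2] := nbhs_square v u (filterI nU nN).
(* One step length strictly inside both squares, so that the same second difference can be expanded
   in either order. *)
pose h := Num.min r1 r2 / 2.
have m0 : 0 < Num.min r1 r2 by rewrite lt_min r10.
have h0 : 0 < h by rewrite divr_gt0.
have hm : h < Num.min r1 r2 by rewrite ltr_pdivrMr // ltr_pMr // ltr1n.
move: (hm); rewrite lt_min => /andP[hr1 hr2].
have small c r : 0 < c < h -> h < r -> `|c| < r.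
  by move=> /andP[c0 ch] hr; rewrite gtr0_norm //; exact: lt_trans hr.
have hh1 : 0 < h < r1 by rewrite h0.
have hh2 : 0 < h < r2 by rewrite h0.
have U1 s t : `|s| < r1 -> `|t| < r1 -> U (p + s *: u + t *: v).
  by move=> s1 t1; have [] := H1 s t s1 t1.
have U2 s t : `|s| < r2 -> `|t| < r2 -> U (p + s *: v + t *: u).
  by move=> s1 t1; have [] := H2 s t s1 t1.
have [c [d [c0 d0 E1]]] := second_difference sf U1 hh1.
have [c' [d' [c0' d0' E2]]] := second_difference sf U2 hh2.
exists (p + c *: u + d *: v), (p + c' *: v + d' *: u); split.
- by have [] := H1 c d (small _ _ c0 hr1) (small _ _ d0 hr1).
- by have [] := H2 c' d' (small _ _ c0' hr2) (small _ _ d0' hr2).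
have hn0 : h != 0 by rewrite gt_eqF.
apply: (mulIf hn0); apply: (mulIf hn0).
apply: etrans (esym E1) _; apply: etrans E2.
(* The second difference is symmetric under exchange of the two middle values. *)
have K (x a b z : R) : x - a - (b - z) = x - b - (a - z).
  by rewrite !opprB addrACA [RHS]addrACA [- b + _]addrC.
by rewrite [p + h *: u + h *: v]addrAC; exact: K.
Qed.

Lemma schwarz V m (f : V -> 'rV[R]_m) (U : set V) p u v : open U ->
  smooth_on U f -> U p ->
  'D_v (fun q => 'D_u f q) p = 'D_u (fun q => 'D_v f q) p.
Proof.
move=> oU sf Up; apply/rowP => i.
have E a b : 'D_b (fun q => 'D_a f q) p 0 i
    = 'D_b (fun q => 'D_a (fun r => f r 0 i : R^o) q) p.
  rewrite -(coord_diff i (smooth_diff (smooth_derive a sf) Up)).2.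
  apply: near_eq_derive; apply: (near_on oU _ Up) => q Uq.
  by rewrite (coord_diff i (smooth_diff sf Uq)).2.
apply: etrans (E u v) _; apply: etrans (esym (E v u)).
exact: (schwarz_scalar _ _ oU (smooth_coord i oU sf) Up).
Qed.

End Schwarz.

(** * Piecewise smooth curves and leaves *)

Section Curves.
Context {R : realType} {n : nat}.
Local Notation E := 'rV[R]_n.
Implicit Types (M : set E) (D : E -> {vspace E}).

(** No reparametrisation: each piece keeps its own time, so the second one has to start at [b];
    [path_shift] arranges this. The target type is general because vector fields along curves are
    glued as well. *)
Definition cat_curve {T : Type} (b : R) (c1 c2 : R -> T) : R -> T :=
  fun t => if t <= b then c1 t else c2 t.

Lemma cat_curve_l T b (c1 c2 : R -> T) t : t <= b -> cat_curve b c1 c2 t = c1 t.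
Proof. by rewrite /cat_curve => ->. Qed.

Lemma cat_curve_r T b (c1 c2 : R -> T) t : c1 b = c2 b -> b <= t ->
  cat_curve b c1 c2 t = c2 t.
Proof.
rewrite le_eqVlt => c12 /predU1P[<-|bt]; first by rewrite cat_curve_l.
by rewrite /cat_curve leNgt bt.
Qed.

Lemma cat_curve_near_l T b (c1 c2 : R -> T) t : t < b ->
  \forall s \near t, c1 s = cat_curve b c1 c2 s.
Proof.
move=> tb; near=> s; rewrite cat_curve_l //; apply/ltW.
by near: s; exact: lt_nbhsl.
Unshelve. all: by end_near. Qed.

Lemma cat_curve_near_r T b (c1 c2 : R -> T) t : b < t ->
  \forall s \near t, c2 s = cat_curve b c1 c2 s.
Proof.
move=> bt; near=> s; rewrite /cat_curve leNgt.
suff -> : b < s by [].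
by near: s; exact: lt_nbhsr.
Unshelve. all: by end_near. Qed.

Lemma piecewise_smooth_cat a b d (c1 c2 : R -> E) : c1 b = c2 b ->
  piecewise_smooth a b c1 -> piecewise_smooth b d c2 ->
  piecewise_smooth a d (cat_curve b c1 c2).
Proof.
move=> c12 [s1 [p1 H1]] [s2 [p2 H2]]; exists (s1 ++ s2); split.
  exact: itv_partition_cat p1 p2.
move=> i; rewrite size_cat => ilt; have [i1|i1] := ltnP i (size s1).
  have [U [g [oU sg gE]]] := H1 i i1; exists U, g; split => // t.
  rewrite -cat_cons !nth_cat /= ltnS (ltnW i1) i1.
  rewrite !(set_nth_default b d) //= ?ltnS ?(ltnW i1) // => tI.
  have [Ut <-] := gE t tI; split => //; apply: cat_curve_l.
  move/andP: tI => [_ /le_trans]; apply.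
  exact: (@itv_partition_nth_le _ _ _ _ _ i.+1 _ p1).
have j2 : (i - size s1 < size s2)%N by rewrite ltn_subLR.
have [U [g [oU sg gE]]] := H2 _ j2; exists U, g; split => // t.
have lastE : last a s1 = b by have [_ /eqP] := p1.
(* The list of left endpoints has the starting time in front; at [i = size s1] the left endpoint is
   the junction [b], the last point of the first partition. *)
have -> : nth d (a :: s1 ++ s2) i = nth d (b :: s2) (i - size s1).
  rewrite -cat_cons nth_cat /= ltnS.
  have [i2|i2] := leqP i (size s1).
    have -> : i = size s1 by apply/eqP; rewrite eqn_leq i1 i2.
    by rewrite subnn -(last_nth d) lastE.
  by rewrite subnS -[X in nth _ (_ :: _) X]prednK // subn_gt0.
rewrite nth_cat ltnNge i1 /= => tI; have [Ut <-] := gE t tI; split => //.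
apply: cat_curve_r => //; move/andP: tI => [+ _]; apply: le_trans.
apply: (@itv_partition_nth_ge _ _ _ _ _ (i - size s1) _ p2).
by rewrite ltnS ltnW.
Qed.

Lemma path_cat M a b d p q r c1 c2 : path_in M a b p q c1 ->
  path_in M b d q r c2 -> path_in M a d p r (cat_curve b c1 c2).
Proof.
move=> [ab s1 c1a c1b M1] [bd s2 c2b c2d M2].
have c12 : c1 b = c2 b by rewrite c1b c2b.
split; first exact: lt_trans bd.
- exact: piecewise_smooth_cat.
- by rewrite cat_curve_l // ltW.
- by rewrite cat_curve_r // ltW.
move=> t /andP[at_ td]; have [tb|bt] := leP t b.
  by rewrite cat_curve_l //; apply: M1; rewrite at_.
by rewrite cat_curve_r // ?ltW //; apply: M2; rewrite td ltW.
Qed.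

Lemma open_preimage_affine (V : normedModType R) (U : set V) (u0 l : V) :
  open U -> open [set t : R^o | U (u0 + t *: l)].
Proof.
move=> oU; apply: (@open_comp _ _ (fun t : R^o => u0 + t *: l)) => // t _.
by apply: differentiable_continuous; exact: affine_diff.
Qed.

Lemma smooth_path M a b (U : set R) (g : R -> E) : a < b -> open U ->
  smooth_on U g -> (forall t, a <= t <= b -> U t /\ M (g t)) ->
  path_in M a b (g a) (g b) g.
Proof.
move=> ab oU sg H; split => // [|t tI]; last by have [] := H t tI.
exists [:: b]; split; first exact: itv_partition1.
move=> [|//] _; exists U, g; split => // t /= tI; split => //.
by have [] := H t tI.
Qed.

Lemma path_shift M a b h p q c : path_in M a b p q c ->
  path_in M (a + h) (b + h) p q (fun t => c (t - h)).
Proof.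
move=> [ab [s [ps H]] ca cb Mc]; split; rewrite ?ltrD2r ?addrK //; last first.
  by move=> t tI; apply: Mc; rewrite lerBrDr lerBlDr.
exists [seq x + h | x <- s]; split.
  case: ps => ps /eqP lb; split.
    rewrite -[a + h]/((fun x => x + h) a) path_map.
    by apply: sub_path ps => x y /=; rewrite ltrD2r.
  by rewrite -[a + h]/((fun x => x + h) a) last_map lb.
move=> i; rewrite size_map => ilt; have [U [g [oU sg gE]]] := H i ilt.
(* The translation is written in affine form so that [smooth_comp_affine] applies. *)
exists [set t : R^o | U (- h + t *: (1 : R^o))].
exists (fun t : R^o => g (- h + t *: (1 : R^o))); split.
- exact: open_preimage_affine.
- exact: smooth_comp_affine.
move=> t; rewrite -[a + h :: _]/[seq x + h | x <- a :: s].
rewrite !(nth_map b) //= ?ltnS ?(ltnW ilt) // => tI.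
have -> : - h + t *: (1 : R^o) = t - h by rewrite [_ *: _]mulr1 addrC.
by apply: gE; rewrite lerBrDr lerBlDr.
Qed.

Lemma derive_shift_curve (V : normedModType R) (c : R -> V) h t :
  'D_1 (fun t : R => c (t - h)) t = 'D_1 c (t - h).
Proof.
have := @derive_comp_affine _ _ _ (c : R^o -> V) (- h) 1 t 1.
have E s : - h + s *: (1 : R^o) = s - h by rewrite [_ *: _]mulr1 addrC.
rewrite E; under eq_fun => s do rewrite E.
by rewrite scale1r.
Qed.

Lemma tangent_curve_shift M D a b h p q c : tangent_curve M D a b p q c ->
  tangent_curve M D (a + h) (b + h) p q (fun t => c (t - h)).
Proof.
move=> [pc [s H]]; split; first exact: path_shift.
exists [seq x + h | x <- s] => t tI ts; rewrite derive_shift_curve.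
apply: H; first by rewrite ltrBrDr ltrBlDr.
by apply: contra ts => ts; apply/mapP; exists (t - h) => //; rewrite subrK.
Qed.

Lemma tangent_curve_cat M D a b d p q r c1 c2 :
  tangent_curve M D a b p q c1 -> tangent_curve M D b d q r c2 ->
  tangent_curve M D a d p r (cat_curve b c1 c2).
Proof.
move=> [p1 [s1 H1]] [p2 [s2 H2]]; split; first exact: path_cat p1 p2.
(* The junction joins the break points: the two velocities need not match there. *)
exists (b :: s1 ++ s2) => t /andP[at_ td].
rewrite inE mem_cat !negb_or => /and3P[tb ts1 ts2].
have c12 : c1 b = c2 b by have [_ _ _ -> _] := p1; have [_ _ -> _ _] := p2.
have [tlb|blt] := ltP t b.
  rewrite -(near_eq_derive _ (cat_curve_near_l c1 c2 tlb)) cat_curve_l ?ltW //.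
  by apply: H1 => //; rewrite at_.
have {}blt : b < t by rewrite lt_neqAle blt eq_sym tb.
rewrite -(near_eq_derive _ (cat_curve_near_r c1 c2 blt)) cat_curve_r ?ltW //.
by apply: H2 => //; rewrite td blt.
Qed.

Lemma leaf_trans M D p q r : leaf M D p q -> leaf M D q r -> leaf M D p r.
Proof.
move=> [a [b [c1 T1]]] [a' [b' [c2 T2]]].
have := tangent_curve_shift (b - a') T2; rewrite addrC subrK => T2'.
by exists a, (b' + (b - a')), (cat_curve b c1 (fun t => c2 (t - (b - a'))));
  exact: tangent_curve_cat T1 T2'.
Qed.

Lemma leaf_refl M D p : M p -> leaf M D p p.
Proof.
move=> Mp; exists 0, 1, (fun=> p); split.
  apply: (@smooth_path M 0 1 setT (fun=> p)) => //; first exact: openT.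
  exact: smooth_cst.
by exists [::] => t _ _; rewrite derive_cst mem0v.
Qed.

Lemma leaf_in M D p q : leaf M D p q -> M p /\ M q.
Proof.
move=> [a [b [c [[ab _ ca cb Mc] _]]]]; rewrite -ca -cb; split; apply: Mc.
  by rewrite lexx ltW.
by rewrite lexx ltW.
Qed.

Lemma within_cat (V : normedModType R) a b d (U1 U2 : R -> V) : a <= b -> b <= d ->
  U1 b = U2 b -> {within `[a, b], continuous U1} ->
  {within `[b, d], continuous U2} ->
  {within `[a, d], continuous (cat_curve b U1 U2)}.
Proof.
move=> ab bd U12 c1 c2.
have -> : `[a, d]%classic = `[a, b]%classic `|` `[b, d]%classic.
  apply/seteqP; split=> t /=; rewrite !in_itv /=.
    move=> /andP[at_ td]; have [tb|bt] := leP t b; first by left; rewrite at_.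
    by right; rewrite td ltW.
  move=> [/andP[at_ tb]|/andP[bt td]]; apply/andP; split=> //.
    exact: le_trans bd.
  exact: le_trans bt.
apply: withinU_continuous; [exact: interval_closed|exact: interval_closed| |].
- apply: subspace_eq_continuous c1 => t; rewrite inE /= in_itv /= => /andP[_ tb].
  by rewrite /= /from_subspace /= cat_curve_l.
- apply: subspace_eq_continuous c2 => t; rewrite inE /= in_itv /= => /andP[bt _].
  by rewrite /= /from_subspace /= cat_curve_r.
Qed.

Lemma parallel_along_cat nabla a b d (c1 c2 U1 U2 : R -> E) : a < b -> b < d ->
  c1 b = c2 b -> U1 b = U2 b ->
  parallel_along nabla a b c1 U1 -> parallel_along nabla b d c2 U2 ->
  parallel_along nabla a d (cat_curve b c1 c2) (cat_curve b U1 U2).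
Proof.
move=> ab bd c12 U12 [w1 [s1 H1]] [w2 [s2 H2]]; split.
  by apply: within_cat; rewrite ?ltW.
exists (b :: s1 ++ s2) => t /andP[at_ td].
rewrite inE mem_cat !negb_or => /and3P[tb ts1 ts2].
have [tlb|blt] := ltP t b.
  rewrite -(near_eq_derive _ (cat_curve_near_l c1 c2 tlb)) !cat_curve_l ?ltW //.
  apply: (near_eq_is_derive (cat_curve_near_l U1 U2 tlb)).
  by apply: H1 => //; rewrite at_.
have {}blt : b < t by rewrite lt_neqAle blt eq_sym tb.
rewrite -(near_eq_derive _ (cat_curve_near_r c1 c2 blt)) !cat_curve_r ?ltW //.
apply: (near_eq_is_derive (cat_curve_near_r U1 U2 blt)).
by apply: H2 => //; rewrite td blt.
Qed.

Lemma parallel_along_restrict nabla a b d (c U : R -> E) : b <= d ->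
  parallel_along nabla a d c U -> parallel_along nabla a b c U.
Proof.
move=> bd [w [s H]]; split.
  apply: continuous_subspaceW w => t /=; rewrite !in_itv /= => /andP[-> tb] /=.
  exact: le_trans bd.
exists s => t /andP[at_ tb] ts; apply: H => //.
by rewrite at_ (lt_le_trans tb).
Qed.

End Curves.

(** * Sums of smooth maps and limits of directional derivatives *)

Section SmoothSum.
Context {R : realType}.
Implicit Types (V W : normedModType R).

Lemma smooth_add V W (U : set V) (f g : V -> W) : open U ->
  smooth_on U f -> smooth_on U g -> smooth_on U (fun q => f q + g q).
Proof.
move=> oU + + vs; elim: vs f g => [|v vs IH] f g sf sg p Up /=.
  by apply: differentiableD; exact: smooth_diff Up.
have := IH _ _ (smooth_derive v sf) (smooth_derive v sg) p Up.
apply: near_eq_differentiable.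
apply: (near_on oU _ Up) => q Uq; apply: iter_derive_eq_on Uq => // r Ur.
rewrite [RHS]deriveD //; apply: diff_derivable.
  exact: smooth_diff sf Ur.
exact: smooth_diff sg Ur.
Qed.

Lemma smooth_sum V W m (U : set V) (f : 'I_m -> V -> W) : open U ->
  (forall i, smooth_on U (f i)) -> smooth_on U (fun q => \sum_i f i q).
Proof.
move=> oU; elim: m f => [|m IH] f sf.
  apply: (@smooth_on_eq _ _ _ _ (fun=> 0)) => // [q _|]; first by rewrite big_ord0.
  exact: smooth_cst.
apply: (@smooth_on_eq _ _ _ _ (fun q => \sum_(i < m) f (widen_ord (leqnSn m) i) q
  + f ord_max q)) => // [q _|]; first by rewrite big_ord_recr.
by apply: smooth_add => //; exact: IH.
Qed.

Lemma cvg_sum W T (F : set_system T) m (f : 'I_m -> T -> W) (l : 'I_m -> W) :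
  Filter F -> (forall i, f i t @[t --> F] --> l i) ->
  \sum_i f i t @[t --> F] --> \sum_i l i.
Proof. by move=> FF fl; apply: cvg_big => //; exact: add_continuous. Qed.

(** Joint continuity in direction and base point. It follows from the expansion of the direction in
    the standard basis, whose finitely many partial derivatives are continuous. *)
Lemma derive_dir_cvg W n (U : set 'rV[R]_n) (f : 'rV[R]_n -> W)
    T (F : set_system T) (c Z : T -> 'rV[R]_n) p w : Filter F ->
  open U -> smooth_on U f -> U p -> c @ F --> p -> Z @ F --> w ->
  'D_(Z t) f (c t) @[t --> F] --> 'D_w f p.
Proof.
move=> FF oU sf Up cp Zw.
have sumE v r : U r -> 'D_v f r = \sum_i v 0 i *: 'D_(delta_mx 0 i) f r.
  by move=> Ur; rewrite {1}[v]row_sum_delta derive_dir_sum //; exact: smooth_diff Ur.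
have nU : \forall t \near F, U (c t) by apply: cp; exact: open_nbhs_nbhs.
have nE : \forall t \near F, \sum_i Z t 0 i *: 'D_(delta_mx 0 i) f (c t)
    = 'D_(Z t) f (c t) by apply: filterS nU => t Ut; rewrite sumE.
apply: cvg_trans (near_eq_cvg nE) _; rewrite sumE //.
apply: cvg_sum => i; apply: cvgZ.
  exact: (cvg_comp _ _ Zw (@coord_continuous R 1 n 0 i w)).
have := differentiable_continuous (smooth_diff (smooth_derive (delta_mx 0 i) sf) Up).
exact: (cvg_comp c (fun r => 'D_(delta_mx 0 i) f r) cp).
Qed.

End SmoothSum.

(** * Connections *)

Section Connection.
Context {R : realType} {n : nat}.
Local Notation E := 'rV[R]_n.
Variables (M : set E) (nabla : (E -> E) -> (E -> E) -> E -> E).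
Hypotheses (oM : open M) (conn : connection M nabla).

Definition christoffel (p u v : E) : E := nabla (cst u) (cst v) p.
Local Notation G := christoffel.

Lemma christoffel_linl p a u u' v : M p ->
  G p (a *: u + u') v = a *: G p u v + G p u' v.
Proof.
move=> Mp.
have := nabla_addl conn (@smooth_cst R E E M (a *: u)) (@smooth_cst _ _ _ M u')
  (@smooth_cst _ _ _ M v) Mp.
have := nabla_scalel conn (@smooth_cst R E R^o M a) (@smooth_cst _ _ _ M u)
  (@smooth_cst _ _ _ M v) Mp.
by rewrite /G => <- <-.
Qed.

Lemma christoffel_linr p a u v v' : M p ->
  G p u (a *: v + v') = a *: G p u v + G p u v'.
Proof.
move=> Mp.
have := nabla_addr conn (@smooth_cst R E E M u) (@smooth_cst _ _ _ M (a *: v))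
  (@smooth_cst _ _ _ M v') Mp.
have := nabla_leibniz conn (@smooth_cst R E R^o M a) (@smooth_cst _ _ _ M u)
  (@smooth_cst _ _ _ M v) Mp.
by rewrite derive_cst scale0r add0r /G => <- <-.
Qed.

Lemma christoffel_suml m p (k : 'I_m -> R) (u : 'I_m -> E) v : M p ->
  G p (\sum_i k i *: u i) v = \sum_i k i *: G p (u i) v.
Proof.
move=> Mp.
have lG : linear (fun u => G p u v) by move=> a u1 u2; exact: christoffel_linl.
pose LM := GRing.isLinear.Build _ _ _ _ _ lG.
pose L : {linear E -> E} := HB.pack (fun u => G p u v) LM.
transitivity (L (\sum_i k i *: u i)); first by [].
rewrite linear_sum; apply: eq_bigr => i _; exact: linearZ.
Qed.

Lemma christoffel_sumr m p (k : 'I_m -> R) u (v : 'I_m -> E) : M p ->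
  G p u (\sum_i k i *: v i) = \sum_i k i *: G p u (v i).
Proof.
move=> Mp.
have lG : linear (G p u) by move=> a u1 u2; exact: christoffel_linr.
pose LM := GRing.isLinear.Build _ _ _ _ _ lG.
pose L : {linear E -> E} := HB.pack (G p u) LM.
transitivity (L (\sum_i k i *: v i)); first by [].
rewrite linear_sum; apply: eq_bigr => i _; exact: linearZ.
Qed.

Lemma christoffelDr p u v v' : M p -> G p u (v + v') = G p u v + G p u v'.
Proof. by move=> Mp; rewrite -[v in LHS]scale1r christoffel_linr // scale1r. Qed.

Lemma nabla0l Y p : smooth_on M Y -> M p -> nabla (fun=> 0) Y p = 0.
Proof.
move=> sY Mp.
have := nabla_scalel conn (@smooth_cst R E R^o M 0) (@smooth_cst _ _ E M 0) sY Mp.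
by rewrite /= !scale0r.
Qed.

Lemma nabla0r X p : smooth_on M X -> M p -> nabla X (fun=> 0) p = 0.
Proof.
move=> sX Mp.
have := nabla_leibniz conn (@smooth_cst R E R^o M 0) sX (@smooth_cst _ _ E M 0) Mp.
by rewrite /= !scale0r scaler0 addr0.
Qed.

Lemma nabla_suml m (X : 'I_m -> E -> E) Y p : (forall i, smooth_on M (X i)) ->
  smooth_on M Y -> M p ->
  nabla (fun r => \sum_i X i r) Y p = \sum_i nabla (X i) Y p.
Proof.
move=> + sY Mp; elim: m X => [|m IH] X sX.
  rewrite big_ord0 -[RHS](nabla0l sY Mp); apply: (nabla_ext conn) => // r _.
  by rewrite big_ord0.
rewrite big_ord_recr /= -IH // -(nabla_addl conn) //; last exact: smooth_sum.
by apply: (nabla_ext conn) => // r _; rewrite big_ord_recr.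
Qed.

Lemma nabla_sumr m X (Y : 'I_m -> E -> E) p : smooth_on M X ->
  (forall i, smooth_on M (Y i)) -> M p ->
  nabla X (fun r => \sum_i Y i r) p = \sum_i nabla X (Y i) p.
Proof.
move=> sX + Mp; elim: m Y => [|m IH] Y sY.
  rewrite big_ord0 -[RHS](nabla0r sX Mp); apply: (nabla_ext conn) => // r _.
  by rewrite big_ord0.
rewrite big_ord_recr /= -IH // -(nabla_addr conn) //; last exact: smooth_sum.
by apply: (nabla_ext conn) => // r _; rewrite big_ord_recr.
Qed.

(** Passage from the axioms to the formula in the ambient chart: both fields are expanded in the
    constant frame [e], on which [nabla] is given by the Christoffel map. The right-hand side makes
    sense for a single vector in place of [X], which is how it is used along curves. *)
Lemma nablaE X Y p : smooth_on M X -> smooth_on M Y -> M p ->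
  nabla X Y p = 'D_(X p) Y p + G p (X p) (Y p).
Proof.
move=> sX sY Mp; pose e i : E := delta_mx 0 i.
have scoordX i : smooth_on M (fun r => X r 0 i *: e i) by exact: smooth_coordZ.
have scoordY i : smooth_on M (fun r => Y r 0 i *: e i) by exact: smooth_coordZ.
have -> : nabla X Y p = \sum_i X p 0 i *: nabla (cst (e i)) Y p.
  rewrite (nabla_ext conn (X' := fun r => \sum_i X r 0 i *: e i) (Y' := Y)) //;
    last by move=> r _; exact: row_sum_delta.
  rewrite nabla_suml //; apply: eq_bigr => i _.
  rewrite (@nabla_scalel _ _ _ _ conn (fun r => X r 0 i) (cst (e i)) Y) //.
    exact: smooth_coord.
  exact: smooth_cst.
have Yi i : nabla (cst (e i)) Y p = 'D_(e i) Y p + G p (e i) (Y p).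
  rewrite (nabla_ext conn (X' := cst (e i)) (Y' := fun r => \sum_j Y r 0 j *: e j)) //;
    last by move=> r _; exact: row_sum_delta.
  rewrite nabla_sumr //; last exact: smooth_cst.
  rewrite [Y p in RHS]row_sum_delta christoffel_sumr //.
  rewrite [in RHS](_ : 'D_(e i) Y p = \sum_j 'D_(e i) Y p 0 j *: e j);
    last exact: row_sum_delta.
  rewrite -big_split /=; apply: eq_bigr => j _.
  rewrite (@nabla_leibniz _ _ _ _ conn (fun r => Y r 0 j) (cst (e i)) (cst (e j))) //.
  - by rewrite (coord_diff j (smooth_diff sY Mp)).2.
  - exact: smooth_coord.
  - exact: smooth_cst.
  - exact: smooth_cst.
under eq_bigr => i _ do rewrite Yi scalerDr.
rewrite big_split /= -christoffel_suml // -row_sum_delta.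
by rewrite -derive_dir_sum -?row_sum_delta //; exact: smooth_diff Mp.
Qed.

Lemma christoffel_cvg T (F : set_system T) (c u v : T -> E) p u0 v0 : Filter F ->
  M p -> c @ F --> p -> u @ F --> u0 -> v @ F --> v0 ->
  G (c t) (u t) (v t) @[t --> F] --> G p u0 v0.
Proof.
move=> FF Mp cp uu0 vv0; pose e i : E := delta_mx 0 i.
have sumE a b r : M r -> G r a b = \sum_i a 0 i *: \sum_j b 0 j *: G r (e i) (e j).
  move=> Mr; rewrite {1}[a]row_sum_delta christoffel_suml //.
  by apply: eq_bigr => i _; rewrite {1}[b]row_sum_delta christoffel_sumr.
have nM : \forall t \near F, M (c t) by apply: cp; exact: open_nbhs_nbhs.
have nE : \forall t \near F, \sum_i u t 0 i *: \sum_j v t 0 j *: G (c t) (e i) (e j)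
    = G (c t) (u t) (v t) by apply: filterS nM => t Mt; rewrite -sumE.
apply: cvg_trans (near_eq_cvg nE) _; rewrite sumE //.
apply: cvg_sum => i; apply: cvgZ.
  exact: (cvg_comp _ _ uu0 (@coord_continuous R 1 n 0 i u0)).
apply: cvg_sum => j; apply: cvgZ.
  exact: (cvg_comp _ _ vv0 (@coord_continuous R 1 n 0 j v0)).
have sG : smooth_on M (fun r => G r (e i) (e j)).
  by apply: (nabla_smooth conn); exact: smooth_cst.
have := differentiable_continuous (smooth_diff sG Mp).
exact: (cvg_comp c (fun r => G r (e i) (e j)) cp).
Qed.

End Connection.

(* Keeps unification from unfolding derivatives to limits. *)
#[local] Opaque derive.

(** * Primitives of continuous functions *)

Section Antiderivative.
Context {R : realType}.

(** Break points of a transport are finite in number, so they are avoided just before [d], even if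
    [d] is one of them. *)
Lemma left_notin (s : seq R) (d : R) : \forall t \near d^'-, (t : R) \notin s.
Proof.
elim: s => [|x s IH]; first exact: nearW.
have nx : \forall t \near d^'-, (t : R) != x.
  have [dx|xd] := leP d x.
    have := nbhs_left_lt d; apply: filterS => t td.
    by rewrite (lt_eqF (lt_le_trans td dx)).
  have := nbhs_left_gt xd; apply: filterS => t xt.
  by rewrite (gt_eqF xt).
by move: nx IH; apply: filterS2 => t tx ts; rewrite inE negb_or tx.
Qed.

(** The three conclusions match what a parallel field needs: the prescribed initial value,
    continuity up to both ends, and the derivative inside. *)
Lemma antiderivative (f : R -> R) (a b : R) : a < b ->
  (forall t, a <= t <= b -> {for t, continuous f}) ->
  exists F : R -> R^o, [/\ F a = 0, {within `[a, b], continuous F} &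
    forall t, a < t < b -> is_derive t (1 : R) F (f t)].
Proof.
move=> ab cf; pose mu := @lebesgue_measure R.
have int : mu.-integrable `[a, b] (EFin \o f).
  apply: continuous_compact_integrable; first exact: segment_compact.
  apply: continuous_in_subspaceT => t; rewrite inE /= in_itv /=; exact: cf.
exists (fun x => (\int[mu]_(t in `[a, x]) f t)%R); split.
- by rewrite set_itv1 Rintegral_set1.
- exact: (parameterized_integral_continuous (ltW ab) int).
move=> t /andP[at_ tb].
have ct : {for t, continuous f} by apply: cf; rewrite !ltW.
have [dF FE] := continuous_FTC1_closed tb int at_ ct.
by apply: DeriveDef; [exact: dF|exact: etrans (esym (derive1E _ _)) FE].
Qed.

End Antiderivative.

(** * Distributions tested through the derivative of a map [z] *)

Section Kernels.
Context {R : realType} {n m : nat}.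
Local Notation E := 'rV[R]_n.
Variables (M : set E) (z : E -> 'rV[R]_m).
Hypotheses (oM : open M) (sz : smooth_on M z).

(** A straight line in the chart of an integral manifold is a curve tangent to [D], so [z] is
    constant on it; its velocity can be made equal to [w]. *)
Lemma tangent_kernel (D : E -> {vspace E}) : integrable_distribution M D ->
  (forall p q, leaf M D p q -> z q = z p) ->
  forall p w, M p -> w \in D p -> 'D_w z p = 0.
Proof.
move=> intD zD p w Mp wD.
have [k [W [psi [oW sW [u0 Wu0 psiu0] HW]]]] := intD p Mp.
pose pf u : k.-tuple E := [tuple param_field psi j u | j < k].
have dirE v u : W u -> 'D_v psi u = \sum_j v 0 j *: (pf u)`_j.
  move=> Wu; rewrite {1}[v]row_sum_delta derive_dir_sum //; last exact: smooth_diff sW Wu.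
  by apply: eq_bigr => j _; rewrite -tnth_nth tnth_mktuple.
have [l wE] : exists l, 'D_l psi u0 = w.
  have [_ bD] := HW u0 Wu0; rewrite psiu0 in bD.
  exists (\row_j coord (pf u0) j w); rewrite dirE //.
  have wD' : w \in <<pf u0>>%VS by rewrite (span_basis bD).
  rewrite [RHS](coord_span wD'); apply: eq_bigr => j _; by rewrite mxE.
have [r r0 Hr] := nbhs_square l 0 (open_nbhs_nbhs (conj oW Wu0)).
have inW s : `|s| < r -> W (u0 + s *: l).
  by move=> sr; have := Hr s 0 sr; rewrite scaler0 addr0 normr0; exact.
(* Points of a leaf are reached in increasing time from [p]. Only [s > 0] is treated here; [s < 0]
   is reached by reversing the line to [- l]. *)
have half l' : (forall s, `|s| < r -> W (u0 + s *: l')) ->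
    forall s, 0 < s < r -> z (psi (u0 + s *: l')) = z p.
  move=> Wl s /andP[s0 sr]; apply: zD; exists 0, s.
  exists (fun t : R => psi (u0 + t *: l')).
  have small t : 0 <= t <= s -> `|t| < r.
    by move=> /andP[t0 ts]; rewrite ger0_norm // (le_lt_trans ts).
  split.
    have := @smooth_path R n M 0 s [set t : R^o | W (u0 + t *: l')]
      (fun t : R => psi (u0 + t *: l')) s0 (@open_preimage_affine R _ W u0 l' oW)
      (@smooth_comp_affine R _ _ psi u0 l' W sW).
    rewrite scale0r addr0 psiu0; apply => t tI.
    have Wt := Wl t (small t tI); split => //.
    by have [] := HW _ Wt.
  exists [::] => t /andP[t0 ts] _.
  have Wt : W (u0 + t *: l') by apply/Wl/small; rewrite !ltW.
  rewrite (@derive_comp_affine _ _ _ psi u0 l' t 1) dirE //.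
  have [_ /basis_mem bD] := HW _ Wt.
  apply: memv_suml => j _; apply: memvZ; apply: bD.
  by apply: mem_nth; rewrite size_tuple.
have zc s : `|s| < r -> z (psi (u0 + s *: l)) = z p.
  move=> sr; have [s0|s0|->] := ltgtP s 0.
  - rewrite -[s]opprK scaleNr -scalerN; apply: half.
      move=> t tr; rewrite scalerN -scaleNr; apply: inW; by rewrite normrN.
    by rewrite oppr_gt0 s0 -(ltr0_norm s0).
  - by apply: half => //; rewrite s0 -(gtr0_norm s0).
  - by rewrite scale0r addr0 psiu0.
have dpsi : differentiable psi u0 by exact: smooth_diff sW Wu0.
have dz : differentiable z (psi u0) by rewrite psiu0; exact: smooth_diff sz Mp.
have u00 : u0 + 0 *: l = u0 by rewrite scale0r addr0.
rewrite -wE -[in LHS]psiu0 -(derive_comp _ dpsi dz) -{1}u00.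
have := @derive_comp_affine _ _ _ (z \o psi) u0 l 0 1; rewrite scale1r => <-.
rewrite -[RHS](@derive_cst _ _ _ (z p) (0 : R^o) 1).
apply: near_eq_derive.
have : \forall s \near (0 : R), `|s| < r by exact: (@nbhs0_lt R R).
by apply: filterS => s; exact: zc.
Qed.

(** Differentiate the constant ['D_(Z q) z q] in the direction [u]: one term moves [Z], the other
    moves the point, and in the latter the two derivatives are exchanged. *)
Lemma dual_derive (Z : E -> E) k p u : smooth_on M Z ->
  (forall q, M q -> 'D_(Z q) z q = k) -> M p ->
  'D_('D_u Z p) z p = - 'D_(Z p) (fun r => 'D_u z r) p.
Proof.
move=> sZ zZ Mp.
pose f s := 'D_(Z s) z s.
have nf : \forall q \near p, f q = cst k q by apply: (near_on oM) Mp.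
have E0 : 'D_u f p = 0 by rewrite (near_eq_derive u nf); exact: derive_cst.
have [_ /(_ u)] := @derive_dir_rule R E _ n M z id Z p oM sz Mp
  (smooth_diff (@smooth_id _ _ M) Mp) (smooth_diff sZ Mp).
have E1 : 'D_('D_u (@id E) p) (fun r => 'D_(Z p) z r) p =
    'D_(Z p) (fun r => 'D_u z r) p.
  by rewrite derive_id; exact: (schwarz _ _ oM sz Mp).
move=> /(etrans (esym E0)) H; apply/eqP; rewrite -addr_eq0 -E1; apply/eqP.
exact: esym H.
Qed.

(** Each half of the bracket contributes a mixed second derivative of [z] by [dual_derive], and the
    two cancel by symmetry. *)
Lemma bracket_kernel (X Z : E -> E) k k' p : smooth_on M X -> smooth_on M Z ->
  (forall q, M q -> 'D_(X q) z q = k) -> (forall q, M q -> 'D_(Z q) z q = k') ->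
  M p -> 'D_(lie_bracket X Z p) z p = 0.
Proof.
move=> sX sZ zX zZ Mp; have dz := smooth_diff sz Mp.
rewrite derive_dirB // (dual_derive _ sX zX) // (dual_derive _ sZ zZ) //.
by rewrite (schwarz _ _ oM sz Mp) subrr.
Qed.

Variables (nabla : (E -> E) -> (E -> E) -> E -> E) (o : E).
Variables (V : {vspace E}) (D : E -> {vspace E}).
Hypotheses (conn : connection M nabla) (trD : transported M nabla o V D).
Hypothesis reach : forall p, M p -> exists a b c, path_in M a b o p c.
Hypothesis zD : forall p w, M p -> w \in D p -> 'D_w z p = 0.

(* Transports backwards along the segment ending at p in the direction u exist
   because w is itself a transport; differentiate 'D_(U t) z = 0 before the
   endpoint and pass to the limit. *)
Lemma parallel_kernel p u w : M p -> w \in D p ->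
  'D_(christoffel nabla p u w) z p = 'D_w (fun r => 'D_u z r) p.
Proof.
move=> Mp wD.
have [r r0 Hr] := nbhs_square u 0 (open_nbhs_nbhs (conj oM Mp)).
have inM s : `|s| < r -> M (p + s *: u).
  by move=> sr; have := Hr s 0 sr; rewrite scaler0 addr0 normr0; exact.
pose e := r / 2.
have e0 : 0 < e by rewrite divr_gt0.
have er : e < r by rewrite ltr_pdivrMr // ltr_pMr // ltr1n.
have Mp0 : M (p - e *: u) by rewrite -scaleNr; apply: inM; rewrite normrN gtr0_norm.
have [a [b [c0 pc0]]] := reach Mp0; have [ab _ _ c0b _] := pc0.
(* The segment is timed to continue the path [c0], which ends at time [b]: it starts at [p - e *: u]
   and reaches [p] at time [d]. *)
pose d := b + e; pose g t : E := (p - d *: u) + t *: u.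
have gE t : g t = p + (t - d) *: u by rewrite /g scalerBl -addrA [- _ + _]addrC.
have bd : b < d by rewrite ltrDl.
have gb : g b = p - e *: u by rewrite gE /d opprD addrA subrr sub0r scaleNr.
have gd : g d = p by rewrite gE subrr scale0r addr0.
have Mg t : b <= t <= d -> M (g t).
  move=> /andP[bt td]; rewrite gE; apply: inM; rewrite distrC.
  rewrite ger0_norm ?subr_ge0 // (le_lt_trans _ er) //.
  by rewrite lerBlDr -lerBlDl /d addrK.
have oU : open [set t : R^o | M (g t)] by exact: open_preimage_affine.
have sg : smooth_on [set t : R^o | M (g t)] g.
  exact: (@smooth_comp_affine _ _ _ id _ u M (@smooth_id _ _ M)).
have pg t : b < t <= d -> path_in M b t (p - e *: u) (g t) g.
  move=> /andP[bt td]; rewrite -gb; apply: smooth_path oU sg _ => // s /andP[bs st].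
  suff ? : M (g s) by [].
  by apply: Mg; rewrite bs (le_trans st).
pose c := cat_curve b c0 g.
have pc t : b < t <= d -> path_in M a t o (g t) c.
  by move=> bt; exact: path_cat pc0 (pg t bt).
have bdd : b < d <= d by rewrite bd lexx.
have [v vV [U [paU Ua Ud]]] : exists2 v, v \in V & parallel_transport nabla a d c v w.
  by apply/(trD (pc d bdd)); rewrite gd.
have UD t : b < t <= d -> U t \in D (g t).
  move=> bt; apply/(trD (pc t bt)); exists v => //; exists U; split => //.
  by apply: parallel_along_restrict paU; case/andP: bt.
have [wU [s Hs]] := paU.
have psi0 : \forall t \near d^'-,
    'D_(U t) (fun r => 'D_u z r) (g t) - 'D_(christoffel nabla (g t) u (U t)) z (g t) = 0.
  near=> t.
  have td : t < d by near: t; apply: nbhs_left_lt.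
  have bt : b < t by near: t; exact: nbhs_left_gt.
  have ts : t \notin s by near: t; exact: left_notin.
  have atd : a < t < d by rewrite (lt_trans ab).
  have Mgt : M (g t) by apply: Mg; rewrite !ltW.
  have := Hs t atd ts; have cg := cat_curve_near_r c0 g bt.
  rewrite -(near_eq_derive _ cg) /c cat_curve_r ?c0b ?gb ?(ltW bt) //.
  rewrite (@derive_comp_affine _ _ _ id (p - d *: u) u t 1) derive_id scale1r.
  move=> [/derivable1_diffP dU UE].
  have dg : differentiable (g : R^o -> E) t by exact: affine_diff.
  have [_ /(_ 1)] := @derive_dir_rule R R^o _ n M z g U t oM sz Mgt dg dU.
  rewrite UE (@derive_comp_affine _ _ _ id (p - d *: u) u t 1) derive_id scale1r.
  (* At all times near [t] the vector [U t'] lies in [D], so the function being differentiated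
     vanishes near [t]. *)
  rewrite (@near_eq_derive _ _ _ _ (fun=> 0)); last first.
    near=> t'; apply: zD.
      by apply: Mg; apply/andP; split; apply: ltW; near: t'; [exact: lt_nbhsr|exact: lt_nbhsl].
    by apply: UD; apply/andP; split; [|apply: ltW]; near: t'; [exact: lt_nbhsr|exact: lt_nbhsl].
  rewrite derive_cst (schwarz _ _ oM sz Mgt) -scaleN1r derive_dirZ; last exact: smooth_diff sz Mgt.
  by rewrite scaleN1r addrC => /esym.
have gcvg : g t @[t --> d^'-] --> p.
  rewrite -[X in _ --> X]gd; apply: cvg_at_left_filter.
  exact: (differentiable_continuous (@affine_diff R E (p - d *: u) u d)).
have ad : a < d by exact: lt_trans bd.
have Ucvg : U t @[t --> d^'-] --> w.
  by rewrite -Ud; have [_ _] := (continuous_within_itvP U ad).1 wU.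
have c1 : 'D_(U t) (fun r => 'D_u z r) (g t) @[t --> d^'-] --> 'D_w (fun r => 'D_u z r) p.
  exact: (derive_dir_cvg _ oM (smooth_derive u sz) Mp gcvg Ucvg).
have c2 : 'D_(christoffel nabla (g t) u (U t)) z (g t) @[t --> d^'-]
    --> 'D_(christoffel nabla p u w) z p.
  have := christoffel_cvg oM conn _ Mp gcvg (cvg_cst u) Ucvg.
  by move=> /(_ _) Gcvg; exact: (derive_dir_cvg _ oM sz Mp gcvg (Gcvg _)).
have FF : Filter (d : R)^'- by exact: _.
pose A t := 'D_(U t) (fun r => 'D_u z r) (g t).
pose B t := 'D_(christoffel nabla (g t) u (U t)) z (g t).
have /(_ FF) c12 := @cvgB _ _ _ _ _ A B _ _ c1 c2.
have c0' : (A - B) t @[t --> d^'-] --> (0 : 'rV[R]_m).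
  apply: cvg_trans (near_eq_cvg _) (cvg_cst _).
  by move: psi0; apply: filterS => t; exact: esym.
apply/esym/eqP; rewrite -subr_eq0; apply/eqP.
have PF : ProperFilter (d : R)^'- by exact: _.
have /(_ PF) E1 := cvg_lim (@norm_hausdorff _ _) c12.
have /(_ PF) E2 := cvg_lim (@norm_hausdorff _ _) c0'.
exact: etrans (esym E1) E2.
Unshelve. all: by end_near. Qed.

(** The ambient derivative of [Y] and the Christoffel term give opposite second derivatives of [z],
    by [dual_derive] and [parallel_kernel]. *)
Lemma nabla_kernel X Y p : smooth_on M X -> smooth_on M Y ->
  (forall q, M q -> Y q \in D q) -> M p -> 'D_(nabla X Y p) z p = 0.
Proof.
move=> sX sY YD Mp; rewrite (nablaE oM conn) //.
rewrite derive_dirD; last exact: smooth_diff sz Mp.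
rewrite parallel_kernel ?YD // (@dual_derive _ 0) // ?addNr // => q Mq.
by apply: zD; rewrite ?YD.
Qed.

End Kernels.

(** * Decomposition in the coordinate frame *)

Section Frames.
Context {R : realType} {n n1 n2 : nat}.
Local Notation E := 'rV[R]_n.

(** Duality of fields and differentials says [S *m L = 1]; since [n = n1 + n2] the matrices are
    square, so also [L *m S = 1], which is the expansion. *)
Lemma frame_decomposition (M : set E) (x : E -> 'rV[R]_n1) (y : E -> 'rV[R]_n2)
    dx dy : n = (n1 + n2)%N -> coordinates M x y dx dy ->
  forall p w, M p -> w = \sum_i ('D_w x p) 0 i *: dx i p +
                         \sum_j ('D_w y p) 0 j *: dy j p.
Proof.
move=> nE co p w Mp; have [sx sy] := co_smooth co.
have ddx := smooth_diff sx Mp; have ddy := smooth_diff sy Mp.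
pose A := \matrix_i dx i p; pose B := \matrix_j dy j p.
pose S := col_mx A B; pose L := row_mx (jacobian x p) (jacobian y p).
have SL : S *m L = 1%:M.
  rewrite mul_col_row scalar_mx_block; congr block_mx;
  apply/row_matrixP => i; rewrite row_mul rowK -?deriveEjacobian // ?row1 ?row0.
  - by have [] := co_dx co i Mp.
  - by have [] := co_dx co i Mp.
  - by have [] := co_dy co i Mp.
  - by have [] := co_dy co i Mp.
have LS : L *m S = 1%:M.
  (* Both matrices are generalised first, so that their dimensions can be rewritten. *)
  move: (S) (L) SL; rewrite -nE => S' L'; exact: mulmx1C.
rewrite [LHS](_ : w = w *m L *m S); last by rewrite -mulmxA LS mulmx1.
rewrite mul_mx_row -!deriveEjacobian // mul_row_col !mulmx_sum_row.
by congr (_ + _); apply: eq_bigr => i _; rewrite rowK.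
Qed.

End Frames.

(** * Differentiability of an inverse matrix *)

Section DetDiff.
Context {R : realType} {V : normedModType R}.

Lemma differentiable_mulE (f g : V -> R^o) p : differentiable f p ->
  differentiable g p -> differentiable (fun q => f q * g q : R^o) p.
Proof. by move=> df dg; have [] := is_diff_scale df dg. Qed.

Lemma differentiable_prodE I (r : seq I) (f : I -> V -> R^o) p :
  (forall i, differentiable (f i) p) ->
  differentiable (fun q => \prod_(i <- r) f i q : R^o) p.
Proof.
move=> df; elim: r => [|i r IH].
  have -> : (fun q => \prod_(i <- [::]) f i q : R^o) = cst (1 : R^o).
    by apply/funext => q; rewrite big_nil.
  exact: differentiable_cst.
have -> : (fun q => \prod_(j <- i :: r) f j q : R^o) =
    (fun q => f i q * \prod_(j <- r) f j q).
  by apply/funext => q; rewrite big_cons.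
exact: differentiable_mulE.
Qed.

Lemma differentiable_det k (A : V -> 'M[R]_k) p :
  (forall i j, differentiable (fun q => A q i j : R^o) p) ->
  differentiable (fun q => \det (A q) : R^o) p.
Proof.
move=> dA; apply: differentiable_bigsum => s.
apply: differentiable_mulE; first exact: differentiable_cst.
by apply: differentiable_prodE => i.
Qed.

(** Cramer's rule: near [p] the entries of [B] are cofactors of [A] divided by a nonzero
    determinant. *)
Lemma differentiable_invmx k (A B : V -> 'M[R]_k) (U : set V) p i j : open U ->
  (forall q, U q -> B q *m A q = 1%:M) -> U p ->
  (forall i j, differentiable (fun q => A q i j : R^o) p) ->
  differentiable (fun q => B q i j : R^o) p.
Proof.
move=> oU BA Up dA.
have unitA q : U q -> A q \in unitmx.
  by move=> Uq; have [] := mulmx1_unit (BA q Uq).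
have BE q : U q -> (\det (A q))^-1 * cofactor (A q) j i = B q i j.
  move=> Uq; have -> : B q = invmx (A q).
    by rewrite -[invmx _]mul1mx -(BA q Uq) mulmxK ?unitA.
  by rewrite /invmx unitA // !mxE.
have nBE := near_on oU BE Up.
apply: near_eq_differentiable nBE _; apply: differentiable_mulE.
  apply: (@differentiableV _ _ (fun q => \det (A q))); first exact: differentiable_det.
  by have := unitA p Up; rewrite unitmxE unitfE.
apply: differentiable_mulE; first exact: differentiable_cst.
apply: differentiable_det => i' j'.
have -> : (fun q => row' j (col' i (A q)) i' j' : R^o) =
    (fun q => A q (lift j i') (lift i j') : R^o).
  by apply/funext => q; rewrite !mxE.
exact: dA.
Qed.

End DetDiff.

(** The span of [k] vectors has dimension at most [k], so a [k]-dimensional [D] contained in it must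
    equal it. *)
Lemma spanning_mem {R : fieldType} {E : vectType R} k (D : {vspace E})
    (f : 'I_k -> E) : \dim D = k ->
  (forall w, w \in D -> exists c : 'I_k -> R, w = \sum_i c i *: f i) ->
  forall i, f i \in D.
Proof.
move=> dD H i; pose t := [tuple f j | j < k].
have fi j : f j \in t by apply/tnthP; exists j; rewrite tnth_mktuple.
have sub : (D <= <<t>>)%VS.
  apply/subvP => w /H[c ->]; apply: memv_suml => j _; apply: memvZ.
  exact: memv_span.
have : D == <<t>>%VS.
  by rewrite eqEdim sub /= dD (leq_trans (dim_span t)) // size_tuple.
by move=> /eqP ->; exact: memv_span.
Qed.

(** * The two foliations *)

Section LocalProduct.
Context {R : realType} {n n1 n2 : nat}.
Local Notation E := 'rV[R]_n.
Variables (M : set E) (o : E) (nabla : (E -> E) -> (E -> E) -> E -> E).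
Hypotheses (M_open : open M) (Mo : M o).
Hypotheses (conn : connection M nabla) (nabla_tf : torsion_free M nabla).
Variables (V1 V2 : {vspace E}).
Hypothesis dimE : n = (n1 + n2)%N.
Variables (D1 D2 : E -> {vspace E}).
Hypotheses (D1_tr : transported M nabla o V1 D1).
Hypotheses (D2_tr : transported M nabla o V2 D2).
Hypotheses (D1_int : integrable_distribution M D1).
Hypotheses (D2_int : integrable_distribution M D2).
Hypothesis M_prod : forall p p', M p -> M p' ->
  exists! q, leaf M D1 p q /\ leaf M D2 p' q.
Variables (x : E -> 'rV[R]_n1) (xinv : 'rV[R]_n1 -> E) (y : E -> 'rV[R]_n2).
Hypothesis x_leaf : leaf_coordinates D1 (leaf M D1 o) x xinv.
Hypothesis x_ext : forall p q, M p -> leaf M D2 p q -> leaf M D1 o q -> x p = x q.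
Hypothesis y_ext : forall p r, M p -> leaf M D1 p r -> leaf M D2 o r -> y p = y r.
Variables (dx : 'I_n1 -> E -> E) (dy : 'I_n2 -> E -> E).
Hypothesis co : coordinates M x y dx dy.
Variables (yq : E -> E -> 'rV[R]_n2) (yqinv : E -> 'rV[R]_n2 -> E).
Hypothesis yq_leaf : forall q, leaf M D1 o q ->
  leaf_coordinates D2 (leaf M D2 q) (yq q) (yqinv q).
Hypothesis yq_aff : forall q, leaf M D1 o q ->
  affine_coordinates nabla (leaf M D2 q) (yq q) (yqinv q).
Variable dyq : 'I_n2 -> E -> E.
Hypothesis dyq_smooth : forall k, smooth_on M (dyq k).
Hypothesis dyqE : forall k p q, M p -> leaf M D2 p q -> leaf M D1 o q ->
  dyq k p = param_field (yqinv q) k (yq q p).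
Variables a ta : 'I_n2 -> 'I_n2 -> E -> R^o.
Hypothesis aE : forall k p, M p -> dyq k p = \sum_l a k l p *: dy l p.
Hypothesis taE : forall l p, M p -> dy l p = \sum_m ta l m p *: dyq m p.

Local Notation G := (christoffel nabla).

Let sx : smooth_on M x. Proof. by have [] := co_smooth co. Qed.
Let sy : smooth_on M y. Proof. by have [] := co_smooth co. Qed.
Let sdx i : smooth_on M (dx i). Proof. by have [] := co_fields co. Qed.
Let sdy j : smooth_on M (dy j). Proof. by have [] := co_fields co. Qed.

(* The curve need not be reversed: the point where leaf D1 p meets leaf D2 q
   also lies on leaf D2 p, so it is p. *)
Lemma leaf2_sym p q : leaf M D2 p q -> leaf M D2 q p.
Proof.
move=> pq; have [Mp Mq] := leaf_in pq.
have [r [[pr1 qr] _]] := M_prod Mp Mq.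
have [s [_ uniq_s]] := M_prod Mp Mp.
have -> : p = r; last by [].
have <- : s = p by apply: uniq_s; split; exact: leaf_refl.
by apply: uniq_s; split => //; exact: leaf_trans pq qr.
Qed.

Lemma leaf_meet p : M p -> exists2 q, leaf M D1 o q & leaf M D2 p q.
Proof. by move=> Mp; have [q [[oq pq] _]] := M_prod Mo Mp; exists q. Qed.

(** The product structure gives the path: inside the leaf of [D1] through [o] to the meeting point
    [q], then inside the leaf of [D2] to [p]. *)
Lemma reachable p : M p -> exists b c d, path_in M b c o p d.
Proof.
move=> Mp; have [q [b [c [d [oq _]]]] /leaf2_sym [b' [c' [d' T]]]] := leaf_meet Mp.
have [pq _] := tangent_curve_shift (c - b') T.
rewrite addrC subrK in pq.
by exists b, (c' + (c - b')), (cat_curve c d (fun t => d' (t - (c - b'))));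
  exact: path_cat oq pq.
Qed.

Lemma x_const p q : leaf M D2 p q -> x q = x p.
Proof.
move=> pq; have [Mp Mq] := leaf_in pq; have [r or qr] := leaf_meet Mq.
by rewrite (x_ext Mq qr or) (x_ext Mp (leaf_trans pq qr) or).
Qed.

Lemma y_const p q : leaf M D1 p q -> y q = y p.
Proof.
move=> pq; have [Mp Mq] := leaf_in pq; have [r [[qr or] _]] := M_prod Mq Mo.
by rewrite (y_ext Mq qr or) (y_ext Mp (leaf_trans pq qr) or).
Qed.

Lemma ker_x p w : M p -> w \in D2 p -> 'D_w x p = 0.
Proof. exact: (tangent_kernel sx D2_int x_const). Qed.

Lemma ker_y p w : M p -> w \in D1 p -> 'D_w y p = 0.
Proof. exact: (tangent_kernel sy D1_int y_const). Qed.

Lemma span_dy p w : M p -> 'D_w x p = 0 -> w = \sum_j ('D_w y p) 0 j *: dy j p.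
Proof.
move=> Mp w0; rewrite [LHS](frame_decomposition dimE co w Mp) w0.
by rewrite big1 ?add0r // => i _; rewrite mxE scale0r.
Qed.

Lemma span_dx p w : M p -> 'D_w y p = 0 -> w = \sum_i ('D_w x p) 0 i *: dx i p.
Proof.
move=> Mp w0; rewrite [LHS](frame_decomposition dimE co w Mp) w0.
by rewrite [X in _ + X]big1 ?addr0 // => i _; rewrite mxE scale0r.
Qed.

Lemma frame_eq0 p w : M p -> 'D_w x p = 0 -> 'D_w y p = 0 -> w = 0.
Proof.
move=> Mp wx wy; rewrite (span_dy Mp wx) wy.
by rewrite big1 // => i _; rewrite mxE scale0r.
Qed.

Lemma basis_dyq p : M p -> basis_of (D2 p) [tuple dyq k p | k < n2].
Proof.
move=> Mp; have [q oq pq] := leaf_meet Mp.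
have := lc_frame (yq_leaf oq) (leaf2_sym pq).
have -> // : [tuple param_field (yqinv q) j (yq q p) | j < n2] =
  [tuple dyq k p | k < n2].
by apply: eq_from_tnth => k; rewrite !tnth_mktuple (dyqE k Mp pq oq).
Qed.

Lemma dyq_in_D2 k p : M p -> dyq k p \in D2 p.
Proof.
move=> Mp; apply: (basis_mem (basis_dyq Mp)).
by apply/tnthP; exists k; rewrite tnth_mktuple.
Qed.

Lemma dy_in_D2 j p : M p -> dy j p \in D2 p.
Proof.
move=> Mp; apply: (@spanning_mem R E n2 (D2 p) (fun j => dy j p)).
  by rewrite (size_basis (basis_dyq Mp)).
move=> w wD; exists (fun j => ('D_w y p) 0 j).
exact: (span_dy Mp (ker_x Mp wD)).
Qed.

(** On this leaf [x_leaf] provides a frame of [D1], hence its dimension [n1]; [ker_y] gives the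
    inclusion in the span of the [dx]. *)
Lemma dx_in_D1_leaf i q : leaf M D1 o q -> dx i q \in D1 q.
Proof.
move=> oq; have [_ Mq] := leaf_in oq.
apply: (@spanning_mem R E n1 (D1 q) (fun i => dx i q)).
  by rewrite (size_basis (lc_frame x_leaf oq)).
move=> w wD; exists (fun i => ('D_w x q) 0 i).
exact: (span_dx Mq (ker_y Mq wD)).
Qed.

(** [affine_coordinates] differentiates in the chart of the leaf. There the coordinate field is
    [dyq k] composed with [yqinv q], and the chain rule gives the derivative along [dyq j]. *)
Lemma parallel_dyq j k p : M p -> 'D_(dyq j p) (dyq k) p + G p (dyq j p) (dyq k p) = 0.
Proof.
move=> Mp; have [q oq pq] := leaf_meet Mp; have qp := leaf2_sym pq.
have L := yq_leaf oq; rewrite -(yq_aff oq j k qp).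
have Wp : (yq q @` leaf M D2 q) (yq q p) by exists p.
have psip := lc_cancel L qp.
have dpsi := smooth_diff (lc_smooth L) Wp.
have -> : 'D_(delta_mx 0 j) (param_field (yqinv q) k) (yq q p) =
    'D_(delta_mx 0 j) (fun u => dyq k (yqinv q u)) (yq q p).
  apply: near_eq_derive; apply: (near_on (lc_open L)) Wp => _ [p' qp' <-].
  rewrite (lc_cancel L qp'); have [_ Mp'] := leaf_in qp'.
  by rewrite (dyqE k Mp' (leaf2_sym qp') oq).
have dk : differentiable (dyq k) (yqinv q (yq q p)).
  by rewrite psip; exact: smooth_diff (dyq_smooth k) Mp.
by rewrite (derive_comp _ dpsi dk) psip !(dyqE _ Mp pq oq).
Qed.

Lemma parallel_dyq_ker k p w : M p -> 'D_w x p = 0 ->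
  'D_w (dyq k) p + G p w (dyq k p) = 0.
Proof.
move=> Mp wx.
have dk := smooth_diff (dyq_smooth k) Mp.
have H j : 'D_(dy j p) (dyq k) p + G p (dy j p) (dyq k p) = 0.
  rewrite (taE j Mp) derive_dir_sum // (christoffel_suml conn) // -big_split big1 //= => m _.
  by rewrite -scalerDr parallel_dyq // scaler0.
rewrite (span_dy Mp wx) derive_dir_sum // (christoffel_suml conn) // -big_split big1 //= => j _.
by rewrite -scalerDr H scaler0.
Qed.

Lemma bracket_dxdy i j p : M p -> lie_bracket (dx i) (dy j) p = 0.
Proof.
move=> Mp; apply: (frame_eq0 Mp).
  apply: (@bracket_kernel _ _ _ M x M_open sx _ _ (delta_mx 0 i) 0) => // q Mq.
    by have [] := co_dx co i Mq.
  by have [] := co_dy co j Mq.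
apply: (@bracket_kernel _ _ _ M y M_open sy _ _ 0 (delta_mx 0 j)) => // q Mq.
  by have [] := co_dx co i Mq.
by have [] := co_dy co j Mq.
Qed.

Lemma nabla_dxdy i j p : M p -> nabla (dy j) (dx i) p = nabla (dx i) (dy j) p.
Proof.
move=> Mp; apply/eqP; rewrite eq_sym -subr_eq0 (nabla_tf (sdx i) (sdy j)) //.
by rewrite bracket_dxdy.
Qed.

Lemma nabla_dxdy_ker i j p : M p -> 'D_(nabla (dx i) (dy j) p) x p = 0.
Proof.
move=> Mp.
apply: (@nabla_kernel _ _ _ M x M_open sx nabla o V2 D2 conn D2_tr) => //.
- exact: reachable.
- exact: ker_x.
- by move=> q Mq; exact: dy_in_D2.
Qed.

Lemma coord_dx (c : 'I_n1 -> R) i p : M p ->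
  'D_(\sum_m c m *: dx m p) x p 0 i = c i.
Proof.
move=> Mp; rewrite derive_dir_sum; last exact: smooth_diff sx Mp.
rewrite summxE (bigD1 i) //= big1 => [|m mi].
  by have [-> _] := co_dx co i Mp; rewrite !mxE !eqxx mulr1 addr0.
by have [-> _] := co_dx co m Mp; rewrite !mxE eqxx eq_sym (negbTE mi) mulr0.
Qed.

Lemma coord_dy (c : 'I_n2 -> R) j p : M p ->
  'D_(\sum_l c l *: dy l p) y p 0 j = c j.
Proof.
move=> Mp; rewrite derive_dir_sum; last exact: smooth_diff sy Mp.
rewrite summxE (bigD1 j) //= big1 => [|l lj].
  by have [_ ->] := co_dy co j Mp; rewrite !mxE !eqxx mulr1 addr0.
by have [_ ->] := co_dy co l Mp; rewrite !mxE eqxx eq_sym (negbTE lj) mulr0.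
Qed.

Lemma dyq_coord k l p : M p -> 'D_(dyq k p) y p 0 l = a k l p.
Proof. by move=> Mp; rewrite (aE k Mp) coord_dy. Qed.

(** The functions [a] and [Gamma] are known through their expansions only; they are differentiable
    as coordinates of ['D_(Z q) z q] for suitable smooth [z] and [Z]. *)
Lemma coord_differentiable m (z : E -> 'rV[R]_m) Z l p : smooth_on M z ->
  smooth_on M Z -> M p -> differentiable (fun q => 'D_(Z q) z q 0 l : R^o) p.
Proof.
move=> sz sZ Mp.
have [dd _] := @derive_dir_rule R E _ n M z id Z p M_open sz Mp
  (smooth_diff (@smooth_id _ _ M) Mp) (smooth_diff sZ Mp).
by have [] := coord_diff l dd.
Qed.

Lemma diff_a k l p : M p -> differentiable (a k l) p.
Proof.
move=> Mp; have := coord_differentiable l sy (dyq_smooth k) Mp.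
apply: near_eq_differentiable.
by apply: (near_on M_open _ Mp) => q Mq; exact: dyq_coord.
Qed.

(** The matrix of [ta] is inverse to that of [a], seen by expanding [dy i] in [dyq] and applying the
    derivative of [y]. *)
Lemma diff_ta l m p : M p -> differentiable (ta l m) p.
Proof.
move=> Mp; pose A q := \matrix_(k, l) a k l q; pose B q := \matrix_(k, l) ta k l q.
have BA q : M q -> B q *m A q = 1%:M.
  move=> Mq; apply/matrixP => i j; rewrite !mxE.
  have [_ /rowP/(_ j)] := co_dy co i Mq; rewrite !mxE eqxx /= eq_sym => <-.
  rewrite (taE i Mq) derive_dir_sum; last exact: smooth_diff sy Mq.
  by rewrite summxE; apply: eq_bigr => k _; rewrite !mxE dyq_coord.
have := @differentiable_invmx R E n2 A B M p l m M_open BA Mp.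
have -> : (fun q => B q l m : R^o) = ta l m by apply/funext => q; rewrite mxE.
apply=> i j; have -> : (fun q => A q i j : R^o) = a i j.
  by apply/funext => q; rewrite mxE.
exact: diff_a.
Qed.

Lemma span_dyq p w : M p -> 'D_w x p = 0 ->
  w = \sum_m (\sum_l ('D_w y p) 0 l * ta l m p) *: dyq m p.
Proof.
move=> Mp wx; rewrite [LHS](span_dy Mp wx).
under eq_bigr => l _ do rewrite (taE l Mp) scaler_sumr.
rewrite exchange_big /=; apply: eq_bigr => m _.
by rewrite scaler_suml; apply: eq_bigr => l _; rewrite scalerA.
Qed.

(** The vector [v] is a combination of the [dy j p], and vanishing torsion turns each covariant
    derivative of [dx k] along [dy j] into one of [dy j], which stays in the kernel of [x]. *)
Lemma nabla_dx_ker k p v : M p -> 'D_v x p = 0 ->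
  'D_('D_v (dx k) p + G p v (dx k p)) x p = 0.
Proof.
move=> Mp vx; have dk := smooth_diff (sdx k) Mp; have dxp := smooth_diff sx Mp.
have -> : 'D_v (dx k) p + G p v (dx k p) =
    \sum_j ('D_v y p) 0 j *: nabla (dy j) (dx k) p.
  rewrite [in LHS](span_dy Mp vx) derive_dir_sum // (christoffel_suml conn) //.
  rewrite -big_split; apply: eq_bigr => j _ /=.
  by rewrite -scalerDr (nablaE M_open conn).
rewrite derive_dir_sum // big1 // => j _.
by rewrite nabla_dxdy // nabla_dxdy_ker // scaler0.
Qed.

(** One smooth piece of a curve in a leaf of [D2]. *)
Lemma dx_in_D1_step (g : R -> E) (U : set R) (al be : R) (s : seq R) :
  al < be -> open U -> smooth_on U g ->
  (forall t, al <= t <= be -> U t /\ M (g t)) ->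
  (forall t, al < t < be -> t \notin s -> 'D_1 g t \in D2 (g t)) ->
  (forall k, dx k (g al) \in D1 (g al)) -> forall k, dx k (g be) \in D1 (g be).
Proof.
move=> ab oU sg HU tan IH k.
have oo_cc t : al < t < be -> al <= t <= be by move=> /andP[? ?]; rewrite !ltW.
have dg t : al <= t <= be -> differentiable g t.
  by move=> /HU[Ut _]; exact: smooth_diff sg Ut.
have cg t : al <= t <= be -> g s @[s --> t] --> g t.
  by move=> tI; exact: differentiable_continuous (dg t tI).
have cF (F : E -> E) t : smooth_on M F -> al <= t <= be ->
    F (g s) @[s --> t] --> F (g t).
  move=> sF tI; have [_ Mt] := HU t tI.
  exact: (cvg_comp g F (cg t tI)) (differentiable_continuous (smooth_diff sF Mt)).
(* [N] is the covariant derivative of [dx k] along [g]. *)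
pose N t := 'D_('D_1 g t) (dx k) (g t) + G (g t) ('D_1 g t) (dx k (g t)).
have cN t : al <= t <= be -> N s @[s --> t] --> N t.
  move=> tI; have [Ut Mt] := HU t tI.
  have c1 : 'D_1 g s @[s --> t] --> 'D_1 g t.
    have d1 : differentiable (fun s => 'D_1 g s) t.
      exact: (smooth_diff (smooth_derive (1 : R) sg) Ut).
    exact: (differentiable_continuous d1).
  apply: cvgD.
    exact: (derive_dir_cvg _ M_open (sdx k) Mt (cg t tI) c1).
  exact: (christoffel_cvg M_open conn _ Mt (cg t tI) c1 (cF _ t (sdx k) tI)).
(* Minus the coefficients of [N] in the frame [dyq]. The formula is used at all times, including
   those in [s], to have a continuous integrand; that it represents [N] is proved where the velocity
   lies in [D2]. *)
pose nu m t : R := - \sum_l ('D_(N t) y (g t)) 0 l * ta l m (g t).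
have cnu m t : al <= t <= be -> {for t, continuous (nu m)}.
  move=> tI; have [Ut Mt] := HU t tI.
  apply: cvgN; apply: (@cvg_sum R R^o) => l; apply: cvgM.
    have c1 := derive_dir_cvg _ M_open sy Mt (cg t tI) (cN t tI).
    exact: (cvg_comp _ _ (c1 _) (@coord_continuous R 1 n2 0 l _)).
  exact: (cvg_comp g (ta l m) (cg t tI)) (differentiable_continuous (diff_ta l m Mt)).
have [Phi HPhi] := choice (fun m => antiderivative ab (cnu m)).
pose S t := \sum_m Phi m t *: dyq m (g t).
pose W t := dx k (g t) + S t.
have Wal : W al = dx k (g al).
  by rewrite /W /S big1 ?addr0 // => m _; have [-> _ _] := HPhi m; rewrite scale0r.
have within F : smooth_on M F -> {within `[al, be], continuous (fun t => F (g t) : E)}.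
  move=> sF; apply: continuous_in_subspaceT => t.
  by rewrite inE /= in_itv /=; exact: cF.
have cW : {within `[al, be], continuous W}.
  move=> t; apply: cvgD; first exact: (within _ (sdx k) t).
  apply: cvg_sum => m; apply: cvgZ; last exact: (within _ (dyq_smooth m) t).
  by have [_ c _] := HPhi m; exact: (c t).
have parW : parallel_along nabla al be g W.
  split=> //; exists s => t tI ts; have tc := oo_cc t tI.
  have [Ut Mt] := HU t tc; have dgt := dg t tc.
  have vx := ker_x Mt (tan t tI ts).
  have NE := span_dyq Mt (nabla_dx_ker k Mt vx).
  have dPhi m : differentiable (Phi m : R^o -> R^o) t /\ 'D_1 (Phi m) t = nu m t.
    by have [_ _ /(_ t tI) [/derivable1_diffP]] := HPhi m.
  have dk := smooth_diff (sdx k) Mt.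
  have dm m := smooth_diff (dyq_smooth m) Mt.
  have dcomp (F : E -> E) : differentiable F (g t) ->
      differentiable (fun s => F (g s)) t.
    by move=> dF; exact: (@differentiable_comp _ _ _ _ g F).
  have dS m := is_diff_scale (dPhi m).1 (dcomp _ (dm m)).
  have dSt : differentiable S t by apply: differentiable_bigsum => m; exact: (dS m).1.
  have dW : differentiable W t by exact: (differentiableD (dcomp _ dk) dSt).
  apply: DeriveDef; first exact: diff_derivable.
  have -> : 'D_1 W t = 'D_1 (fun s => dx k (g s)) t + 'D_1 S t.
    by apply: deriveD; apply: diff_derivable => //; exact: dcomp.
  rewrite (derive_comp _ dgt dk) derive_sumE => [|m]; last exact: (dS m).1.
  apply/eqP; rewrite -addr_eq0; apply/eqP.
  rewrite -[nabla _ _ _]/(G (g t) ('D_1 g t) (W t)) (christoffelDr conn) //.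
  rewrite (christoffel_sumr conn) // addrACA -big_split /=.
  have -> : \sum_m ('D_1 (fun s => Phi m s *: dyq m (g s)) t +
      Phi m t *: G (g t) ('D_1 g t) (dyq m (g t))) =
      \sum_m nu m t *: dyq m (g t).
    apply: eq_bigr => m _; rewrite (dS m).2 (dPhi m).2 (derive_comp _ dgt (dm m)).
    by rewrite -addrA -scalerDr parallel_dyq_ker // scaler0 addr0.
  rewrite -/(N t) [N t in LHS]NE -big_split big1 //= => m _.
  by rewrite /nu scaleNr addrN.
have [_ Mal] : U al /\ M (g al) by apply: HU; rewrite lexx ltW.
have [_ Mbe] : U be /\ M (g be) by apply: HU; rewrite lexx ltW.
(* The path from [o] is shifted to end at time [al], so that [g] continues it. *)
have [a0 [b0 [c0 /(path_shift (al - b0))]]] := reachable Mal.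
rewrite addrC [b0 + _]addrC subrK; set a1 := _ + a0; set c1 := fun _ => _ => pc1.
have [a1al _ _ c1al _] := pc1.
have pg := smooth_path ab oU sg HU.
have [v vV [U0 [pU0 U0a U0al]]] := (D1_tr pc1 _).1 (IH k).
have WD : W be \in D1 (g be).
  apply/(D1_tr (path_cat pc1 pg)); exists v => //; exists (cat_curve al U0 W).
  split; last by rewrite cat_curve_r ?ltW // U0al Wal.
    by apply: parallel_along_cat => //; rewrite U0al Wal.
  by rewrite cat_curve_l ?ltW.
have SD : S be \in D2 (g be).
  by apply: memv_suml => m _; apply: memvZ; exact: dyq_in_D2.
(* The derivative of [y] vanishes along [W be], by [D1], and along [dx k], hence along [S be];
   membership in [D2] gives the same for [x]. *)
suff S0 : S be = 0 by move: WD; rewrite /W S0 addr0.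
apply: (frame_eq0 Mbe); first exact: ker_x.
have := ker_y Mbe WD; rewrite derive_dirD; last exact: smooth_diff sy Mbe.
by have [_ ->] := co_dx co k Mbe; rewrite add0r.
Qed.

Lemma dx_in_D1 k p : M p -> dx k p \in D1 p.
Proof.
move=> Mp; have [q oq /leaf2_sym qp] := leaf_meet Mp.
have [b [d [c [[bd [s [ps H]] cb cd Mc] [s' tan]]]]] := qp.
(* Induction over the break points of a curve from the leaf through [o] to [p]: index [0] is the
   start, index [size s] the end. *)
suff claim i : (i <= size s)%N ->
    forall k, dx k (c (nth d (b :: s) i)) \in D1 (c (nth d (b :: s) i)).
  have := claim (size s) (leqnn _) k; rewrite -(last_nth d).
  by have [_ /eqP ->] := ps; rewrite cd.
elim: i => [_|i IHi ilt] k'; first by rewrite /= cb; exact: dx_in_D1_leaf.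
have {IHi}IH := IHi (ltnW ilt); rewrite [nth d (b :: s) i.+1]/= in k' *.
have [U [g [oU sg gE]]] := H i ilt.
set al := nth d (b :: s) i in gE IH *; set be := nth d s i in gE *.
have albe : al < be by have [/(pathP d)/(_ i ilt)] := ps.
have ala : b <= al by exact: (itv_partition_nth_ge (leqW ilt) ps).
have bed : be <= d by exact: (@itv_partition_nth_le _ _ _ _ _ i.+1 ilt ps).
have cg_al : c al = g al by apply: (gE al _).2; rewrite lexx ltW.
have cg_be : c be = g be by apply: (gE be _).2; rewrite lexx ltW.
rewrite cg_be; move: IH; rewrite cg_al => IH.
apply: (@dx_in_D1_step g U al be s' albe oU sg) IH k' => t tI.
  have [Ut <-] := gE t tI; split => //; apply: Mc.
  by case/andP: tI => alt tbe; rewrite (le_trans ala) // (le_trans tbe).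
move=> ts'; case/andP: (tI) => alt tbe.
have tcc : al <= t <= be by rewrite !ltW.
(* [c] and the smooth extension [g] agree on the closed piece, so their derivatives are compared
   strictly inside it. *)
have <- : 'D_1 c t = 'D_1 g t.
  apply: near_eq_derive.
  have n1' : \forall r \near t, al < r by exact: lt_nbhsr.
  have n2' : \forall r \near t, r < be by exact: lt_nbhsl.
  move: n1' n2'; apply: filterS2 => r r1 r2; apply: (gE r _).2.
  by rewrite !ltW.
rewrite -(gE t tcc).2; apply: tan => //.
by rewrite (le_lt_trans ala) // (lt_le_trans tbe).
Qed.

Lemma nabla_dydx0 i j p : M p -> nabla (dy j) (dx i) p = 0.
Proof.
move=> Mp; apply: (frame_eq0 Mp); first by rewrite nabla_dxdy // nabla_dxdy_ker.
apply: (@nabla_kernel _ _ _ M y M_open sy nabla o V1 D1 conn D1_tr) => //.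
- exact: reachable.
- exact: ker_y.
- by move=> q Mq; exact: dx_in_D1.
Qed.

(** Serves both directions: [dy] is a frame parallel along [dx i], while [dx] and [dyq] are frames
    parallel along [dy j]. *)
Lemma derive_parallel_sum m (Y : E -> E) (f : 'I_m -> E -> R^o) (F : 'I_m -> E -> E)
    p w : (forall q, M q -> Y q = \sum_i f i q *: F i q) -> M p ->
  (forall i, differentiable (f i) p) -> (forall i, differentiable (F i) p) ->
  (forall i, 'D_w (F i) p + G p w (F i p) = 0) ->
  'D_w Y p + G p w (Y p) = \sum_i 'D_w (f i) p *: F i p.
Proof.
move=> YE Mp df dF parF; have d i := is_diff_scale (df i) (dF i).
rewrite (near_eq_derive w (near_on M_open YE Mp)) YE // derive_sumE => [|i];
  last exact: (d i).1.
rewrite (christoffel_sumr conn) // -big_split; apply: eq_bigr => i _ /=.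
by rewrite (d i).2 -addrA -scalerDr parF scaler0 addr0.
Qed.

Lemma curvature_dxdy Z i j p : smooth_on M Z ->
  (forall q, M q -> nabla (dy j) Z q = 0) -> M p ->
  curvature nabla (dx i) (dy j) Z p = - nabla (dy j) (nabla (dx i) Z) p.
Proof.
move=> sZ Z0 Mp; rewrite /curvature.
rewrite (nabla_ext conn (X' := dx i) (Y' := fun=> 0) _ Z0 Mp) //.
rewrite (nabla0r conn) // sub0r.
rewrite (nabla_ext conn (X := lie_bracket (dx i) (dy j)) (X' := fun=> 0)
  (Y' := Z) _ _ Mp) //; last first.
  by move=> q Mq; exact: bracket_dxdy.
by rewrite (nabla0l conn) // subr0.
Qed.

Lemma curvature_dx (Gamma : 'I_n1 -> 'I_n1 -> 'I_n1 -> E -> R^o) :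
  (forall i k p, M p -> nabla (dx i) (dx k) p = \sum_m Gamma i k m p *: dx m p) ->
  forall i j k p, M p -> curvature nabla (dx i) (dy j) (dx k) p =
    - \sum_m 'D_(dy j p) (Gamma i k m) p *: dx m p.
Proof.
move=> GammaE i j k p Mp.
have sY : smooth_on M (nabla (dx i) (dx k)) by exact: nabla_smooth.
rewrite curvature_dxdy //; last by move=> q Mq; exact: nabla_dydx0.
congr (- _); rewrite (nablaE M_open conn) //.
apply: (derive_parallel_sum (GammaE i k) Mp) => m.
- have := coord_differentiable m sx sY Mp; apply: near_eq_differentiable.
  by apply: (near_on M_open _ Mp) => q Mq; rewrite GammaE // coord_dx.
- exact: smooth_diff (sdx m) Mp.
- by have := nabla_dydx0 m j Mp; rewrite (nablaE M_open conn).
Qed.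

Lemma nabla_dx_dyq i k p : M p ->
  nabla (dx i) (dyq k) p = \sum_l 'D_(dx i p) (a k l) p *: dy l p.
Proof.
move=> Mp; rewrite (nablaE M_open conn) //.
apply: (derive_parallel_sum (aE k) Mp) => l.
- exact: diff_a.
- exact: smooth_diff (sdy l) Mp.
- by have := nabla_dydx0 i l Mp; rewrite nabla_dxdy // (nablaE M_open conn).
Qed.

Lemma curvature_dyq i j k p : M p -> curvature nabla (dx i) (dy j) (dyq k) p =
  - \sum_m 'D_(dy j p) (fun r => \sum_l 'D_(dx i r) (a k l) r * ta l m r : R^o) p
      *: dyq m p.
Proof.
move=> Mp.
have sY : smooth_on M (nabla (dx i) (dyq k)) by exact: nabla_smooth.
have par0 q m : M q -> 'D_(dy j q) (dyq m) q + G q (dy j q) (dyq m q) = 0.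
  by move=> Mq; apply: parallel_dyq_ker => //; have [] := co_dy co j Mq.
rewrite curvature_dxdy //; last first.
  by move=> q Mq; rewrite (nablaE M_open conn) //; exact: par0.
congr (- _); rewrite (nablaE M_open conn) //.
apply: derive_parallel_sum => // [q Mq|m|m|m].
- rewrite nabla_dx_dyq //.
  (* Change from the frame [dy] to [dyq], which is the one parallel along [dy j]; this is where [ta]
     enters the coefficients. *)
  under eq_bigr => l _ do rewrite (taE l Mq) scaler_sumr.
  rewrite exchange_big /=; apply: eq_bigr => m _.
  by rewrite scaler_suml; apply: eq_bigr => l _; rewrite scalerA.
- apply: differentiable_bigsum => l; apply: differentiable_mulE; last exact: diff_ta.
  have := coord_differentiable l sy sY Mp; apply: near_eq_differentiable.
  by apply: (near_on M_open _ Mp) => q Mq; rewrite nabla_dx_dyq // coord_dy.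
- exact: smooth_diff (dyq_smooth m) Mp.
- exact: par0.
Qed.

End LocalProduct.

Theorem proposition8 (R : realType) (n n1 n2 : nat)
  (* the manifold, the connection, the base point *)
  (M : set 'rV[R]_n) (o : 'rV[R]_n)
  (nabla : ('rV[R]_n -> 'rV[R]_n) -> ('rV[R]_n -> 'rV[R]_n) ->
           'rV[R]_n -> 'rV[R]_n)
  (M_open : open M) (M_sc : simply_connected M) (Mo : M o)
  (nabla_conn : connection M nabla) (nabla_tf : torsion_free M nabla)
  (* the holonomy algebra and its two faithful representations *)
  (V1 V2 : {vspace 'rV[R]_n})
  (dimV1 : \dim V1 = n1) (dimV2 : \dim V2 = n2)
  (V_sum : (V1 + V2)%VS = fullv) (V_cap : (V1 :&: V2)%VS = 0%VS)
  (V1_inv : invariant_under (lie_algebra (restricted_holonomy M nabla o)) V1)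
  (V2_inv : invariant_under (lie_algebra (restricted_holonomy M nabla o)) V2)
  (V1_faith : faithful_on (lie_algebra (restricted_holonomy M nabla o)) V1)
  (V2_faith : faithful_on (lie_algebra (restricted_holonomy M nabla o)) V2)
  (* the two foliations *)
  (D1 D2 : 'rV[R]_n -> {vspace 'rV[R]_n})
  (D1_tr : transported M nabla o V1 D1) (D2_tr : transported M nabla o V2 D2)
  (D1_int : integrable_distribution M D1) (D2_int : integrable_distribution M D2)
  (M_prod : forall p p', M p -> M p' ->
     exists! q, leaf M D1 p q /\ leaf M D2 p' q)
  (* the coordinates x_o on F_1(o) and y_o on F_2(o), with inverse charts *)
  (x : 'rV[R]_n -> 'rV[R]_n1) (xinv : 'rV[R]_n1 -> 'rV[R]_n)
  (y : 'rV[R]_n -> 'rV[R]_n2) (yinv : 'rV[R]_n2 -> 'rV[R]_n)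
  (x_leaf : leaf_coordinates D1 (leaf M D1 o) x xinv)
  (x_aff : affine_coordinates nabla (leaf M D1 o) x xinv)
  (y_leaf : leaf_coordinates D2 (leaf M D2 o) y yinv)
  (y_aff : affine_coordinates nabla (leaf M D2 o) y yinv)
  (* their extension to M, and the coordinate fields on M *)
  (x_ext : forall p q, M p -> leaf M D2 p q -> leaf M D1 o q -> x p = x q)
  (y_ext : forall p r, M p -> leaf M D1 p r -> leaf M D2 o r -> y p = y r)
  (dx : 'I_n1 -> 'rV[R]_n -> 'rV[R]_n) (dy : 'I_n2 -> 'rV[R]_n -> 'rV[R]_n)
  (xy_coord : coordinates M x y dx dy)
  (* the coordinates y_q on the leaves F_2(q), q in F_1(o) *)
  (yq : 'rV[R]_n -> 'rV[R]_n -> 'rV[R]_n2)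
  (yqinv : 'rV[R]_n -> 'rV[R]_n2 -> 'rV[R]_n)
  (yq_leaf : forall q, leaf M D1 o q ->
     leaf_coordinates D2 (leaf M D2 q) (yq q) (yqinv q))
  (yq_aff : forall q, leaf M D1 o q ->
     affine_coordinates nabla (leaf M D2 q) (yq q) (yqinv q))
  (yq_tr : forall q a b c j, tangent_curve M D1 a b o q c ->
     parallel_transport nabla a b c (dy j o)
       (param_field (yqinv q) j (yq q q)))
  (* the vector fields d/dy_q on M *)
  (dyq : 'I_n2 -> 'rV[R]_n -> 'rV[R]_n)
  (dyq_smooth : forall k, smooth_on M (dyq k))
  (dyqE : forall k p q, M p -> leaf M D2 p q -> leaf M D1 o q ->
     dyq k p = param_field (yqinv q) k (yq q p))
  (* the functions a, \tilde a and Gamma *)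
  (a ta : 'I_n2 -> 'I_n2 -> 'rV[R]_n -> R^o)
  (aE : forall k p, M p -> dyq k p = \sum_l a k l p *: dy l p)
  (taE : forall l p, M p -> dy l p = \sum_m ta l m p *: dyq m p)
  (Gamma : 'I_n1 -> 'I_n1 -> 'I_n1 -> 'rV[R]_n -> R^o)
  (GammaE : forall i k p, M p ->
     nabla (dx i) (dx k) p = \sum_m Gamma i k m p *: dx m p) :
  forall p, M p ->
    (forall (i : 'I_n1) (j : 'I_n2) (k : 'I_n1),
       curvature nabla (dx i) (dy j) (dx k) p
       = - \sum_m 'D_(dy j p) (Gamma i k m) p *: dx m p) /\
    (forall (i : 'I_n1) (j k : 'I_n2),
       curvature nabla (dx i) (dy j) (dyq k) p
       = - \sum_m
           'D_(dy j p)
             (fun r => \sum_l 'D_(dx i r) (a k l) r * ta l m r : R^o) p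
           *: dyq m p).
Proof.
have dimE : n = (n1 + n2)%N.
  have := dimv_disjoint_sum V_cap.
  by rewrite V_sum dimvf dimV1 dimV2 /dim /= mul1n.
move=> p Mp; split=> [i j k|i j k].
  exact: (curvature_dx M_open Mo nabla_conn nabla_tf dimE D1_tr D2_tr D1_int
    D2_int M_prod x_leaf x_ext y_ext xy_coord yq_leaf yq_aff dyq_smooth dyqE
    aE taE GammaE).
exact: (curvature_dyq M_open Mo nabla_conn nabla_tf dimE D1_tr D2_tr D1_int
  D2_int M_prod x_leaf x_ext y_ext xy_coord yq_leaf yq_aff dyq_smooth dyqE
  aE taE).
Qed.
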